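(* Let $\Omega\subset\mathbb R^2$ be an open bounded polygonal domain, let $\mathbf f\in (L^2(\Omega))^2$, let $\mu:\Omega\to\mathbb R$ satisfy $0<\underline\lambda\le\mu(\mathbf x)\le\overline\lambda$ for a.e. $\mathbf x\in\Omega$ and $|\mu(\mathbf x)-\mu(\overline{\mathbf x})|\le\Lambda|\mathbf x-\overline{\mathbf x}|$ for all $\mathbf x,\overline{\mathbf x}\in\overline\Omega$, and let $\lambda>0$ be the penalty parameter. Let $(\mathcal M,\mathcal M^*,\mathcal M^{**})$ be a triple of meshes of $\Omega$ as described in the context, satisfying the non-degeneracy hypothesis. Then the penalty cell-centered finite element scheme has exactly one solution, i.e. there exists exactly one pair $(\mathbf u_h,p_h)\in\mathcal H_{\mathcal D}\times\mathcal L_{\mathcal D}$ such that $$\int_\Omega \mu\,\nabla_{\mathcal D,\mu}\mathbf u_h:\nabla_{\mathcal D,\mu}\mathbf v_h\,d\mathbf x-\int_\Omega \operatorname{div}_{\mathcal D,\mu}(\mathbf v_h)\,p_h\,d\mathbf x=\int_\Omega \mathbf f\cdot P(\mathbf v_h)\,d\mathbf x\quad\text{for all }\mathbf v_h\in\mathcal H_{\mathcal D},$$ $$\int_\Omega \operatorname{div}_{\mathcal D,\mu}(\mathbf u_h)\,q_h\,d\mathbf x=-\lambda h\int_\Omega p_hq_h\,d\mathbf x\quad\text{for all }q_h\in\mathcal L_{\mathcal D}.$$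
   Context: Meshes. $\mathcal M$ (primal mesh) is a finite partition of $\Omega$ into polygonal cells $K$, each with a mesh point $\mathbf x_K\in K$. For two neighbouring cells $K,L\in\mathcal M$ with common edge $\sigma$, the segment $[\mathbf x_K,\mathbf x_L]$ meets $\sigma$ at a unique point $\mathbf x_\sigma$. The dual mesh $\mathcal M^*$ has one cell $K^*$ for each vertex of $\mathcal M$; its mesh point $\mathbf x_{K^*}$ is that vertex. The third mesh $\mathcal M^{**}$ is the triangulation of $\Omega$ consisting of the triangles $(\mathbf x_{K^*},\mathbf x_K,\mathbf x_L)$, for each interior primal edge $\sigma$ common to $K$ and $L$ and each endpoint $\mathbf x_{K^*}$ of $\sigma$, together with the triangles $(\mathbf x_{K^*},\mathbf x_K,\mathbf x_\sigma)$, for each boundary primal edge $\sigma\subset\partial\Omega$ of a cell $K$, with $\mathbf x_\sigma$ a chosen point in the interior of $\sigma$, and each endpoint $\mathbf x_{K^*}$ of $\sigma$. The dual cell $K^*$ is the union of all triangles of $\mathcal M^{**}$ having $\mathbf x_{K^*}$ as a vertex in this construction. All triangles and sub-triangles are non-degenerate. The mesh size is $h=\sup_{K^{**}\in\mathcal M^{**}}\operatorname{diam}(K^{**})$. Discrete spaces. $\mathcal H_{\mathcal D}$ is the set of all $\mathbf v_h=((\mathbf v_K)_{K\in\mathcal M},(\mathbf v_{K^*})_{K^*\in\mathcal M^*})$ with $\mathbf v_K,\mathbf v_{K^*}\in\mathbb R^2$ and $\mathbf v_{K^*}=0$ whenever $\mathbf x_{K^*}\in\partial\Omega$; components are written $v_h^{(i)}$,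 $i=1,2$. $\mathcal L_{\mathcal D}$ is the set of functions on $\Omega$ that are constant on each dual cell $K^*$, $q=\sum_{K^*}q_{K^*}\chi_{K^*}$. Discrete operators. On the triangle $(\mathbf x_{K^*},\mathbf x_K,\mathbf x_L)$ associated with an interior edge $\sigma$, $P(v_h^{(i)})$ is the continuous function, affine on each of the two sub-triangles $(\mathbf x_{K^*},\mathbf x_K,\mathbf x_\sigma)$ and $(\mathbf x_{K^*},\mathbf x_L,\mathbf x_\sigma)$, with values $v_K^{(i)},v_L^{(i)},v_{K^*}^{(i)}$ at $\mathbf x_K,\mathbf x_L,\mathbf x_{K^*}$ and value $v_{\sigma,K^*}^{(i)}$ at $\mathbf x_\sigma$, where $v_{\sigma,K^*}^{(i)}$ is determined by the local flux conservation $$\mu_K\,(\nabla P(v_h^{(i)}))|_{(\mathbf x_{K^*},\mathbf x_K,\mathbf x_\sigma)}\cdot n^K_{[\mathbf x_\sigma,\mathbf x_{K^*}]}+\mu_L\,(\nabla P(v_h^{(i)}))|_{(\mathbf x_{K^*},\mathbf x_L,\mathbf x_\sigma)}\cdot n^L_{[\mathbf x_\sigma,\mathbf x_{K^*}]}=0.$$ Here $\mu_K,\mu_L$ are the averages of $\mu$ on $K,L$, and $n^K_{[\mathbf x_\sigma,\mathbf x_{K^*}]}$ (resp. $n^L_{[\mathbf x_\sigma,\mathbf x_{K^*}]}$) is the normal vector to $[\mathbf x_\sigma,\mathbf x_{K^*}]$, outward to $(\mathbf x_{K^*},\mathbf x_K,\mathbf x_\sigma)$ (resp. $(\mathbf x_{K^*},\mathbf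 x_L,\mathbf x_\sigma)$), with length equal to that of the segment. On a boundary triangle $(\mathbf x_{K^*},\mathbf x_K,\mathbf x_\sigma)$, $P(v_h^{(i)})$ is affine with values $v^{(i)}_{K^*},v^{(i)}_K$ and $0$ at $\mathbf x_{K^*},\mathbf x_K,\mathbf x_\sigma$. The discrete gradient $\nabla_{\mathcal D,\mu}v_h^{(i)}$ is the (piecewise constant) gradient of $P(v_h^{(i)})$ on each (sub-)triangle. Further, $P(\mathbf v_h)=(P(v_h^{(1)}),P(v_h^{(2)}))$, $\nabla_{\mathcal D,\mu}\mathbf u_h:\nabla_{\mathcal D,\mu}\mathbf v_h=\sum_{i=1}^2\nabla_{\mathcal D,\mu}u_h^{(i)}\cdot\nabla_{\mathcal D,\mu}v_h^{(i)}$, and $\operatorname{div}_{\mathcal D,\mu}\mathbf v_h=\nabla_{\mathcal D,\mu}v_h^{(1)}\cdot\mathbf e_1+\nabla_{\mathcal D,\mu}v_h^{(2)}\cdot\mathbf e_2$ with $\mathbf e_1,\mathbf e_2$ the canonical basis of $\mathbb R^2$. Non-degeneracy hypothesis. For every triangle $(\mathbf x_{K^*},\mathbf x_K,\mathbf x_L)$ of $\mathcal M^{**}$ associated with an interior primal edge $\sigma$ common to $K$ and $L$ and an endpoint $\mathbf x_{K^*}$ of $\sigma$, $$-\frac{\mu_K\,n^K_{[\mathbf x_\sigma,\mathbf x_{K^*}]}\cdot n_{[\mathbf x_{K^*},\mathbf x_K]}}{2m_{(\mathbf x_{K^*},\mathbf x_K,\mathbf x_\sigma)}}-\frac{\mu_L\,n^L_{[\mathbf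 x_\sigma,\mathbf x_{K^*}]}\cdot n_{[\mathbf x_{K^*},\mathbf x_L]}}{2m_{(\mathbf x_{K^*},\mathbf x_L,\mathbf x_\sigma)}}\neq0,$$ where $n_{[\mathbf x_{K^*},\mathbf x_K]}$ (resp. $n_{[\mathbf x_{K^*},\mathbf x_L]}$) is the outward normal to the corresponding sub-triangle on that edge, with length equal to the edge length, and $m$ denotes area; this makes $v_{\sigma,K^*}^{(i)}$ uniquely determined. *)

(* Defs.v *)
From HB Require Import structures.
From mathcomp Require Import all_boot all_order all_algebra.
From mathcomp Require Import all_classical all_reals all_analysis.

Set Implicit Arguments.
Unset Strict Implicit.
Unset Printing Implicit Defensive.
Import Order.TTheory GRing.Theory Num.Theory.
Import numFieldNormedType.Exports.
Local Open Scope classical_set_scope.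
Local Open Scope ring_scope.

Section plane.
Variable R : realType.
Implicit Types (x y A B C : R * R) (s : seq (R * R)).

Definition leb2 :
    {measure set (measurableTypeR R * measurableTypeR R) -> \bar R} :=
  (@lebesgue_measure R \x @lebesgue_measure R)%E.

Definition dot x y : R := x.1 * y.1 + x.2 * y.2.

(* Euclidean norm: the library norm [`|x|] of [R * R] is the sup norm. *)
Definition enorm x : R := Num.sqrt (dot x x).

Definition det2 x y : R := x.1 * y.2 - x.2 * y.1.

Definition diam (S : set (R * R)) : R :=
  sup [set enorm (x - y) | x in S & y in S].

Definition frontier (S : set (R * R)) : set (R * R) := closure S `\` S°.

(* Closed convex hull of the points of [s]; [ohull] is its relative interior
   when the points are affinely independent. *)
Definition hull s : set (R * R) :=
  [set x | exists w : 'I_(size s) -> R,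
     [/\ forall i, 0 <= w i, \sum_i w i = 1 & x = \sum_i w i *: s`_i]].

Definition ohull s : set (R * R) :=
  [set x | exists w : 'I_(size s) -> R,
     [/\ forall i, 0 < w i, \sum_i w i = 1 & x = \sum_i w i *: s`_i]].

Definition polygonal_domain (S : set (R * R)) : Prop :=
  [/\ open S, S !=set0, connected S, bounded_set S &
      exists2 l : seq ((R * R) * (R * R)),
        forall p, p \in l -> p.1 != p.2 &
        frontier S = \bigcup_(p in [set` l]) hull [:: p.1; p.2]].

Definition area A B C : R := `|det2 (B - A) (C - A)| / 2.

(* Normal to [A, B], of length |B - A|, outward to the triangle (A, B, C). *)
Definition onormal A B C : R * R :=
  let n := ((B - A).2, - (B - A).1) in if 0 < dot n (C - A) then - n else n.

(* The affine function with values a, b, c at A, B, C, in barycentric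
   coordinates. *)
Definition affine A B C (a b c : R) x : R :=
  (a * det2 (B - x) (C - x) + b * det2 (C - x) (A - x)
   + c * det2 (A - x) (B - x)) / det2 (B - A) (C - A).

Definition grad (g : R * R -> R) x : R * R :=
  ('D_(1, 0) g x, 'D_(0, 1) g x).

(* Gradient of that affine function; it is constant, hence may be taken at A. *)
Definition affine_grad A B C (a b c : R) : R * R := grad (affine A B C a b c) A.

Definition average (g : R * R -> R) (S : set (R * R)) : R :=
  (\int[leb2]_(x in S) g x) / fine (leb2 S).

End plane.

Record mesh (R : realType) (Om : set (R * R)) := Mesh {
  cellI : finType;
  edgeI : finType;
  vertI : finType;
  cell : cellI -> set (R * R);
  xcell : cellI -> R * R;
  xvert : vertI -> R * R;
  esrc : edgeI -> vertI;
  etgt : edgeI -> vertI;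
  (* An edge e is common to [ecell e] and L if [eopp e = Some L], and is a
     boundary edge of [ecell e] if [eopp e = None]. *)
  ecell : edgeI -> cellI;
  eopp : edgeI -> option cellI;
  xedge : edgeI -> R * R;

  eside e K := (ecell e == K) || (eopp e == Some K);
  eend e v := (v == esrc e) || (v == etgt e);
  eseg e := [:: xvert (esrc e); xvert (etgt e)];
  (* The triangle of the third mesh carried by the edge e and its end v. *)
  tri e v := if eopp e is Some L
             then [:: xvert v; xcell (ecell e); xcell L]
             else [:: xvert v; xcell (ecell e); xedge e];

  cell_polygonal : forall K, polygonal_domain (cell K);
  cell_sub : forall K, cell K `<=` Om;
  cell_disjoint : forall K L, K != L -> cell K `&` cell L = set0;
  cell_cover : Om `<=` \bigcup_K closure (cell K);
  cell_frontier : forall K,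
    frontier (cell K) = \bigcup_(e in [set e | eside e K]) hull (eseg e);

  xvert_inj : injective xvert;
  vert_end : forall v, exists e, eend e v;
  edge_neq : forall e, esrc e != etgt e;
  edge_meet : forall e e', e != e' ->
    hull (eseg e) `&` hull (eseg e') `<=`
      [set xvert v | v in [set v | eend e v && eend e' v]];
  edge_opp : forall e L, eopp e = Some L -> L != ecell e;
  edge_int : forall e L, eopp e = Some L -> ohull (eseg e) `<=` Om;
  edge_bnd : forall e, eopp e = None -> hull (eseg e) `<=` frontier Om;

  xcell_in : forall K, cell K (xcell K);
  xedge_int : forall e L, eopp e = Some L ->
    hull [:: xcell (ecell e); xcell L] `&` hull (eseg e) = [set xedge e];
  xedge_bnd : forall e, eopp e = None -> ohull (eseg e) (xedge e);

  tri_nondeg : forall e v L, eend e v -> eopp e = Some L ->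
    area (xvert v) (xcell (ecell e)) (xcell L) != 0;
  subtri_nondeg : forall K e v, eside e K -> eend e v ->
    area (xvert v) (xcell K) (xedge e) != 0;
  tri_cover :
    closure Om = \bigcup_(t in [set t | eend t.1 t.2]) hull (tri t.1 t.2);
  tri_disjoint : forall e v e' v', eend e v -> eend e' v' ->
    (e, v) != (e', v') -> ohull (tri e v) `&` ohull (tri e' v') = set0;
  tri_conform : forall e v e' v', eend e v -> eend e' v' ->
    hull (tri e v) `&` hull (tri e' v') =
      hull [seq x <- tri e v | x \in tri e' v']
}.

Section scheme.
Variables (R : realType) (Om : set (R * R)) (M : mesh Om) (mu : R * R -> R).

(* The interior makes the dual cells pairwise disjoint, so that the elements of
   [LD] below are constant on each of them. *)
Definition dual_cell (v : vertI M) : set (R * R) :=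
  (\bigcup_(e in [set e | eend e v]) hull (tri e v))°.

Definition mesh_size : R :=
  sup [set diam (hull (tri t.1 t.2)) |
        t in [set t : edgeI M * vertI M | eend t.1 t.2]].

Definition discrete_field := ({ffun cellI M -> R * R} * {ffun vertI M -> R * R})%type.

Definition HD : set discrete_field :=
  [set vh : discrete_field | forall v : vertI M, frontier Om (xvert v) -> vh.2 v = 0].

Definition LD : set (R * R -> R) :=
  [set q | exists c : vertI M -> R, q = fun x => \sum_v c v * \1_(dual_cell v) x].

Definition discrete_scalar := ((cellI M -> R) * (vertI M -> R))%type.

Definition comp1 (vh : discrete_field) : discrete_scalar :=
  (fun K => (vh.1 K).1, fun v => (vh.2 v).1).
Definition comp2 (vh : discrete_field) : discrete_scalar :=
  (fun K => (vh.1 K).2, fun v => (vh.2 v).2).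

(* mu_K (grad P) . n^K on the sub-triangle (v, K, e), where t is the value at
   the point of the edge e. *)
Definition flux (s : discrete_scalar) (e : edgeI M) (v : vertI M) (K : cellI M)
    (t : R) : R :=
  average mu (cell K) *
  dot (affine_grad (xvert v) (xcell K) (xedge e) (s.2 v) (s.1 K) t)
      (onormal (xedge e) (xvert v) (xcell K)).

(* The value at the point of e, seen from its end v: the solution of the flux
   conservation equation, which is unique under [flux_nondegenerate]. *)
Definition edge_value (s : discrete_scalar) (e : edgeI M) (v : vertI M) : R :=
  if eopp e is Some L
  then xget 0 [set t | flux s e v (ecell e) t + flux s e v L t = 0]
  else 0.

Definition is_sub (t : cellI M * edgeI M * vertI M) : bool :=
  eside t.1.2 t.1.1 && eend t.1.2 t.2.

Definition sub (t : cellI M * edgeI M * vertI M) : set (R * R) :=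
  ohull [:: xvert t.2; xcell t.1.1; xedge t.1.2].

(* P and the discrete gradient are given on the open sub-triangles, and are 0
   on the (Lebesgue-null) rest of the domain. *)
Definition P (s : discrete_scalar) (x : R * R) : R :=
  \sum_(t | is_sub t)
    affine (xvert t.2) (xcell t.1.1) (xedge t.1.2)
      (s.2 t.2) (s.1 t.1.1) (edge_value s t.1.2 t.2) x * \1_(sub t) x.

Definition dgrad (s : discrete_scalar) (x : R * R) : R * R :=
  \sum_(t | is_sub t)
    (\1_(sub t) x : R) *:
    affine_grad (xvert t.2) (xcell t.1.1) (xedge t.1.2)
      (s.2 t.2) (s.1 t.1.1) (edge_value s t.1.2 t.2).

Definition Pvec (vh : discrete_field) (x : R * R) : R * R :=
  (P (comp1 vh) x, P (comp2 vh) x).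

Definition dgrad_ddot (uh vh : discrete_field) (x : R * R) : R :=
  dot (dgrad (comp1 uh) x) (dgrad (comp1 vh) x) +
  dot (dgrad (comp2 uh) x) (dgrad (comp2 vh) x).

Definition ddiv (vh : discrete_field) (x : R * R) : R :=
  dot (dgrad (comp1 vh) x) (1, 0) + dot (dgrad (comp2 vh) x) (0, 1).

Definition flux_nondegenerate : Prop :=
  forall e v L, eend e v -> eopp e = Some L ->
  let coef K :=
    average mu (cell K) *
    dot (onormal (xedge e) (xvert v) (xcell K))
        (onormal (xvert v) (xcell K) (xedge e)) /
    (2 * area (xvert v) (xcell K) (xedge e)) in
  - coef (@ecell _ _ M e) - coef L != 0.

End scheme.

(* Main.v *)
Require Import Defs.
From mathcomp Require Import all_boot all_order all_algebra.
From mathcomp Require Import all_classical all_reals all_analysis.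
From mathcomp Require Import measurable_realfun.
From mathcomp Require Import ring lra.
Import Order.TTheory GRing.Theory Num.Theory.
Import numFieldNormedType.Exports.
Local Open Scope classical_set_scope.
Local Open Scope ring_scope.

(* The scheme is a square linear system, so it suffices to show that the
   homogeneous problem has only the zero solution. Testing it with (u, p)
   gives [int mu |grad u|^2 + lambda h int p^2 = 0]. The second term forces
   p = 0, the dual cells being disjoint and non-empty. The first one makes the
   gradient vanish on every sub-triangle, so the values of u at the vertices of
   each triangle agree. Two closed triangles that meet share a vertex by
   conformity, hence carry the same value; since the closure of the domain is
   connected, covered by finitely many of them, and u vanishes at some boundary
   vertex, u = 0. *)

(** * Linear algebra and plane geometry *)

(** In the sum of the two equations the divergence terms cancel on the diagonal, and the penalty
    term controls the pressure because [0 < mesh_size M]. The coordinates [dof] keep a pair of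
    values at every vertex, and [field_of] discards those at boundary vertices. The matrix is
    therefore singular along these coordinates, so existence comes from compatibility with the
    kernel instead of invertibility, and uniqueness is proved separately, on the fields themselves.
    The passage from integrals to points rests on one fact: a non-empty open set is not negligible.
    It turns the almost everywhere bounds on [mu], which is continuous on the domain, into bounds at
    every point of the domain. It also gives a zero in every open piece of the domain when a
    non-negative integrand has zero integral. Gradients and pressures being constant on their
    pieces, one zero per piece is enough. The pieces are only known to lie in the closure of the
    domain, so they are first cut with the domain. *)

(* The kernel condition says that the right-hand side vanishes on the kernel of
   the transposed matrix, i.e. that it lies in the row space. *)
Lemma bilinear_solvable (F : fieldType) (I : finType)
    (a : (I -> F) -> (I -> F) -> F) (l : (I -> F) -> F) :
  (forall k d1 d2 e, a (fun i => k * d1 i + d2 i) e = k * a d1 e + a d2 e) ->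
  (forall k d1 d2 e, a e (fun i => k * d1 i + d2 i) = k * a e d1 + a e d2) ->
  (forall k d1 d2, l (fun i => k * d1 i + d2 i) = k * l d1 + l d2) ->
  (forall d, a d d = 0 -> l d = 0) ->
  exists d, forall e, a d e = l e.
Proof.
move=> al ar ll ker.
pose de (i : 'I_#|I|) (j : I) : F := (j == enum_val i)%:R.
pose vec n (x : 'I_n -> F) (y : 'I_n -> I -> F) j := \sum_i x i * y i j.
have vecS n x y : @vec n.+1 x y = (fun j => x ord0 * y ord0 j +
    vec n (fun i => x (lift ord0 i)) (fun i => y (lift ord0 i)) j).
  by apply/funext => j; rewrite /vec big_ord_recl.
have lin0 (g : (I -> F) -> F) :
    (forall k d1 d2, g (fun i => k * d1 i + d2 i) = k * g d1 + g d2) ->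
    g (fun=> 0) = 0.
  move=> gl; have := gl (-1) (fun=> 0) (fun=> 0).
  by rewrite mulr0 addr0 mulN1r addNr.
have lins (g : (I -> F) -> F) :
    (forall k d1 d2, g (fun i => k * d1 i + d2 i) = k * g d1 + g d2) ->
    forall n x y, g (@vec n x y) = \sum_i x i * g (y i).
  move=> gl; elim=> [|n IH] x y; last by rewrite vecS gl IH big_ord_recl.
  rewrite big_ord0; rewrite -(lin0 g gl); congr g; apply/funext => j.
  by rewrite /vec big_ord0.
have vecE (d : I -> F) : d = vec _ (fun i => d (enum_val i)) de.
  apply/funext => j; rewrite /vec (bigD1 (enum_rank j)) //= /de enum_rankK eqxx.
  rewrite mulr1 big1 ?addr0 // => i ne.
  case: eqVneq => [E|]; last by rewrite mulr0.
  by rewrite E enum_valK eqxx in ne.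
pose A : 'M[F]_#|I| := \matrix_(i, j) a (de i) (de j).
pose b : 'rV[F]_#|I| := \row_j l (de j).
(* A column [d] of [cokermx A] satisfies [A d = 0], hence [a d d = 0], and [ker] makes it orthogonal
   to [b]; this is membership in the row space. *)
have sub : (b <= A)%MS.
  rewrite submxE; apply/eqP/rowP => j; rewrite [RHS]mxE mxE.
  pose d := vec _ (fun i => cokermx A i j) de.
  transitivity (l d).
    by rewrite /d lins //; apply: eq_bigr => i _; rewrite [b _ _]mxE mulrC.
  apply: ker; rewrite {1}/d (lins (fun x => a x d)); last by move=> *; exact: al.
  rewrite big1 // => i _; rewrite /d lins; last by move=> *; exact: ar.
  have := mulmx_coker A => /matrixP /(_ i j); rewrite [RHS]mxE mxE => E.
  rewrite (_ : \sum_ _ _ = 0) ?mulr0 // -[RHS]E; apply: eq_bigr => k _.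
  by rewrite [A _ _]mxE mulrC.
have /submxP[D DE] := sub.
exists (vec _ (fun i => D ord0 i) de) => e; rewrite (vecE e).
rewrite (lins (a _)); last by move=> *; exact: ar.
rewrite (lins l) //; apply: eq_bigr => j _; congr (_ * _).
have /rowP/(_ j) := DE; rewrite mxE [RHS]mxE => ->.
rewrite (lins (fun x => a x (de j))); last by move=> *; exact: al.
by apply: eq_bigr => i _; rewrite !mxE.
Qed.

Section plane_geometry.
Variable R : realType.
Implicit Types (A B C x y : R * R).

Lemma pair_scaleE (k : R) x : k *: x = (k * x.1, k * x.2).
Proof. by case: x. Qed.

Lemma pair_addE x y : x + y = (x.1 + y.1, x.2 + y.2).
Proof. by case: x; case: y. Qed.

Lemma pair_oppE x : - x = (- x.1, - x.2).
Proof. by case: x. Qed.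

Definition pairE := (pair_scaleE, pair_addE, pair_oppE).

(** The inverse of the determinant is treated as an indeterminate, so the expansion also covers
    degenerate triangles, with the convention that [0] has inverse [0]. *)
Lemma affineE A B C (a b c : R) x : affine A B C a b c x =
  affine A B C a b c 0 +
  (a * (B.2 - C.2) + b * (C.2 - A.2) + c * (A.2 - B.2)) / det2 (B - A) (C - A) * x.1 +
  (a * (C.1 - B.1) + b * (A.1 - C.1) + c * (B.1 - A.1)) / det2 (B - A) (C - A) * x.2.
Proof.
rewrite /affine; move: (_^-1) => D; rewrite /det2; case: A B C x => [A1 A2] [B1 B2] [C1 C2] [x1 x2] /=.
ring.
Qed.

Lemma continuous_affine A B C (a b c : R) : continuous (affine A B C a b c).
Proof.
move=> x; rewrite (_ : affine A B C a b c = fun x => affine A B C a b c 0 +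
  (a * (B.2 - C.2) + b * (C.2 - A.2) + c * (A.2 - B.2)) / det2 (B - A) (C - A) * x.1 +
  (a * (C.1 - B.1) + b * (A.1 - C.1) + c * (B.1 - A.1)) / det2 (B - A) (C - A) * x.2).
  apply: cvgD; [apply: cvgD|].
  - exact: cvg_cst.
  - by apply: cvgM; [exact: cvg_cst|exact: cvg_fst].
  - by apply: cvgM; [exact: cvg_cst|exact: cvg_snd].
by apply/funext => y; exact: affineE.
Qed.

(** In any direction the difference quotient of an affine function is constant off [0], so the
    derivative is the limit of an eventually constant function. *)
Lemma affine_gradE A B C (a b c : R) : affine_grad A B C a b c =
  ((a * (B.2 - C.2) + b * (C.2 - A.2) + c * (A.2 - B.2)) / det2 (B - A) (C - A),
   (a * (C.1 - B.1) + b * (A.1 - C.1) + c * (B.1 - A.1)) / det2 (B - A) (C - A)).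
Proof.
have D v : 'D_v (affine A B C a b c) A =
  (a * (B.2 - C.2) + b * (C.2 - A.2) + c * (A.2 - B.2)) / det2 (B - A) (C - A) * v.1 +
  (a * (C.1 - B.1) + b * (A.1 - C.1) + c * (B.1 - A.1)) / det2 (B - A) (C - A) * v.2.
  rewrite /derive; apply: cvg_lim => //; apply: cvg_near_cst.
  near=> h.
  have h0 : h != 0 by near: h; exact: nbhs_dnbhs_neq.
  rewrite /= affineE [X in _ - X]affineE !pairE /=.
  rewrite [X in X = _](_ : _ = h^-1 * (h *
   ((a * (B.2 - C.2) + b * (C.2 - A.2) + c * (A.2 - B.2)) / det2 (B - A) (C - A) * v.1 +
  (a * (C.1 - B.1) + b * (A.1 - C.1) + c * (B.1 - A.1)) / det2 (B - A) (C - A) * v.2))).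
    by rewrite mulrA mulVf ?mul1r.
  by rewrite /GRing.scale /=; congr (_ * _); rewrite !pairE /=; ring.
by rewrite /affine_grad /grad !D /= !mulr0 !mulr1 addr0 add0r.
Unshelve. all: by end_near.
Qed.

Lemma area_neq0 A B C : (area A B C != 0) = (det2 (B - A) (C - A) != 0).
Proof. by rewrite /area mulf_eq0 normr_eq0 invr_eq0 pnatr_eq0 orbF. Qed.

Lemma area_AA A B : area A A B = 0.
Proof.
rewrite /area (_ : det2 _ _ = 0) ?normr0 ?mul0r //.
by rewrite /det2; case: A B => [? ?] [? ?] /=; ring.
Qed.

Lemma area_BB A B : area A B B = 0.
Proof.
rewrite /area (_ : det2 _ _ = 0) ?normr0 ?mul0r //.
by rewrite /det2; case: A B => [? ?] [? ?] /=; ring.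
Qed.

Lemma affine_grad_eq0 A B C (a b c : R) : area A B C != 0 ->
  affine_grad A B C a b c = 0 -> a = c /\ b = c.
Proof.
rewrite area_neq0 affine_gradE => D0 [] /eqP + /eqP.
rewrite !mulf_eq0 invr_eq0 (negbTE D0) !orbF => /eqP E1 /eqP E2.
(* The gradient is paired with [A - C], then with [B - C]: the increments of the affine function
   along these vectors are [a - c] and [b - c]. *)
have Ea : (a - c) * det2 (B - A) (C - A) = 0.
  transitivity ((A.1 - C.1) * (a * (B.2 - C.2) + b * (C.2 - A.2) + c * (A.2 - B.2)) +
     (A.2 - C.2) * (a * (C.1 - B.1) + b * (A.1 - C.1) + c * (B.1 - A.1))); last first.
    by rewrite E1 E2 !mulr0 addr0.
  by rewrite /det2; case: A B C {D0 E1 E2} => [? ?] [? ?] [? ?] /=; ring.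
have Eb : (b - c) * det2 (B - A) (C - A) = 0.
  transitivity ((B.1 - C.1) * (a * (B.2 - C.2) + b * (C.2 - A.2) + c * (A.2 - B.2)) +
     (B.2 - C.2) * (a * (C.1 - B.1) + b * (A.1 - C.1) + c * (B.1 - A.1))); last first.
    by rewrite E1 E2 !mulr0 addr0.
  by rewrite /det2; case: A B C {D0 E1 E2 Ea} => [? ?] [? ?] [? ?] /=; ring.
by split; apply/eqP; rewrite -subr_eq0; apply/eqP;
  [move: Ea|move: Eb] => /eqP; rewrite mulf_eq0 (negbTE D0) orbF => /eqP.
Qed.

(** The sign choice in [onormal] compensates the sign of the determinant, so the orientation drops
    out. The right-hand side is minus the gradient of the barycentric coordinate of [C], which ties
    the normals of the non-degeneracy hypothesis to gradients. *)
Lemma onormalE A B C : area A B C != 0 ->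
  (2 * area A B C)^-1 *: onormal A B C =
  ((B.2 - A.2) / det2 (B - A) (C - A), (A.1 - B.1) / det2 (B - A) (C - A)).
Proof.
rewrite area_neq0 => D0.
have dE : dot ((B - A).2, - (B - A).1) (C - A) = - det2 (B - A) (C - A).
  by rewrite /dot /det2 /=; case: A B C {D0} => [? ?] [? ?] [? ?] /=; ring.
rewrite /onormal dE oppr_gt0 /area mulrCA mulfV ?pnatr_eq0 // mulr1.
case: ltP => d0; rewrite !pairE /=; congr (_, _).
- by rewrite ltr0_norm // invrN; ring.
- by rewrite ltr0_norm // invrN; ring.
- by rewrite ger0_norm //; ring.
- by rewrite ger0_norm //; ring.
Qed.

Lemma affine_grad_lin A B C (k a b c a' b' c' : R) :
  affine_grad A B C (k * a + a') (k * b + b') (k * c + c') =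
  k *: affine_grad A B C a b c + affine_grad A B C a' b' c'.
Proof. by rewrite !affine_gradE !pairE /=; congr (_, _); ring. Qed.

Lemma affine_lin A B C (k a b c a' b' c' : R) x :
  affine A B C (k * a + a') (k * b + b') (k * c + c') x =
  k * affine A B C a b c x + affine A B C a' b' c' x.
Proof. by rewrite /affine; ring. Qed.

Lemma affine_bary A B C (a b c u v w : R) : det2 (B - A) (C - A) != 0 ->
  u + v + w = 1 ->
  affine A B C a b c (u *: A + v *: B + w *: C) = a * u + b * v + c * w.
Proof.
move=> D0 E; rewrite /affine; apply: (canLR (mulfK D0)).
have -> : w = 1 - u - v by lra.
rewrite /det2; case: A B C {D0} => [? ?] [? ?] [? ?] /=.
by rewrite /GRing.scale /=; ring.
Qed.

Lemma bary_affine A B C x : det2 (B - A) (C - A) != 0 ->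
  x = affine A B C 1 0 0 x *: A + affine A B C 0 1 0 x *: B + affine A B C 0 0 1 x *: C.
Proof.
move=> D0; rewrite !pairE /=; rewrite [LHS]surjective_pairing /affine; congr (_, _); move: D0; rewrite /det2;
case: A B C x => [? ?] [? ?] [? ?] [? ?] /= D0; field; exact: D0.
Qed.

Lemma affine_sum1 A B C x : det2 (B - A) (C - A) != 0 ->
  affine A B C 1 0 0 x + affine A B C 0 1 0 x + affine A B C 0 0 1 x = 1.
Proof.
rewrite /affine /det2;
case: A B C x => [? ?] [? ?] [? ?] [? ?] /= D0; field; exact: D0.
Qed.

Lemma ohull3P A B C x : ohull [:: A; B; C] x <->
  exists u : R * R * R, [/\ 0 < u.1.1, 0 < u.1.2, 0 < u.2, u.1.1 + u.1.2 + u.2 = 1 &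
     x = u.1.1 *: A + u.1.2 *: B + u.2 *: C].
Proof.
split=> [[w [w0]]|[[[a b] c]/= [a0 b0 c0 s1 ->]]].
  rewrite !big_ord_recl !big_ord0 /= !addr0 => s1 ->.
  by exists (w ord0, w (lift ord0 ord0), w (lift ord0 (lift ord0 ord0))); split;
    rewrite /= -?addrA.
exists (fun i : 'I_3 => [:: a; b; c]`_i); split.
- by case=> [[|[|[|]]]].
- by rewrite !big_ord_recl big_ord0 /= addr0 addrA.
- by rewrite !big_ord_recl big_ord0 /= addr0 addrA.
Qed.

Lemma hull3P A B C x : hull [:: A; B; C] x <->
  exists u : R * R * R, [/\ 0 <= u.1.1, 0 <= u.1.2, 0 <= u.2, u.1.1 + u.1.2 + u.2 = 1 &
     x = u.1.1 *: A + u.1.2 *: B + u.2 *: C].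
Proof.
split=> [[w [w0]]|[[[a b] c]/= [a0 b0 c0 s1 ->]]].
  rewrite !big_ord_recl !big_ord0 /= !addr0 => s1 ->.
  by exists (w ord0, w (lift ord0 ord0), w (lift ord0 (lift ord0 ord0))); split;
    rewrite /= -?addrA.
exists (fun i : 'I_3 => [:: a; b; c]`_i); split.
- by case=> [[|[|[|]]]].
- by rewrite !big_ord_recl big_ord0 /= addr0 addrA.
- by rewrite !big_ord_recl big_ord0 /= addr0 addrA.
Qed.

Lemma hull2P A B x : hull [:: A; B] x <->
  exists2 t : R, 0 <= t <= 1 & x = (1 - t) *: A + t *: B.
Proof.
split=> [[w [w0]]|[t /andP[t0 t1] ->]].
  rewrite !big_ord_recl !big_ord0 /= !addr0 => s1 ->.
  exists (w (lift ord0 ord0)); first by rewrite w0 -s1 lerDr w0.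
  by rewrite -s1 addrK.
exists (fun i : 'I_2 => [:: 1 - t; t]`_i); split.
- by case=> [[|[|]]] //= _; rewrite subr_ge0.
- by rewrite !big_ord_recl big_ord0 /= addr0 subrK.
- by rewrite !big_ord_recl big_ord0 /= addr0.
Qed.

Lemma ohull2P A B x (t : R) : 0 < t < 1 ->
  x = (1 - t) *: A + t *: B -> ohull [:: A; B] x.
Proof.
move=> /andP[t0 t1] ->.
exists (fun i : 'I_2 => [:: 1 - t; t]`_i); split.
- by case=> [[|[|]]] //= _; rewrite subr_gt0.
- by rewrite !big_ord_recl big_ord0 /= addr0 subrK.
- by rewrite !big_ord_recl big_ord0 /= addr0.
Qed.

Lemma ohull_sub_hull (s : seq (R * R)) : ohull s `<=` hull s.
Proof. by move=> x [w [w0 s1 ->]]; exists w; split=> // i; exact/ltW. Qed.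

(** In a non-degenerate triangle the weights of a point are unique and are affine functions of it;
    openness then follows from continuity. *)
Lemma ohull_baryP A B C x : area A B C != 0 ->
  ohull [:: A; B; C] x <->
  [/\ 0 < affine A B C 1 0 0 x, 0 < affine A B C 0 1 0 x & 0 < affine A B C 0 0 1 x].
Proof.
rewrite area_neq0 => D0; rewrite ohull3P; split.
  move=> [[[a b] c]/= [a0 b0 c0 s1 ->]]; rewrite !affine_bary //.
  by rewrite !mul0r !mul1r !add0r !addr0.
move=> [a0 b0 c0].
exists (affine A B C 1 0 0 x, affine A B C 0 1 0 x, affine A B C 0 0 1 x).
by split=> //=; [exact: affine_sum1|exact: bary_affine].
Qed.

Lemma open_ohull A B C : area A B C != 0 -> open (ohull [:: A; B; C]).
Proof.
move=> D0; rewrite (_ : ohull _ = affine A B C 1 0 0 @^-1` [set r | 0 < r] `&`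
  (affine A B C 0 1 0 @^-1` [set r | 0 < r] `&` affine A B C 0 0 1 @^-1` [set r | 0 < r])).
  by apply: openI; [|apply: openI]; apply: open_comp;
    do ?[exact: open_gt|by move=> ? _; exact: continuous_affine].
by apply/seteqP; split=> x /=; rewrite ohull_baryP //; [case|case=> ? []].
Qed.

Lemma ohull3_neq0 A B C : ohull [:: A; B; C] !=set0.
Proof.
exists (3^-1 *: A + 3^-1 *: B + 3^-1 *: C); apply/ohull3P.
by exists (3^-1, 3^-1, 3^-1); split=> //=; rewrite ?invr_gt0 ?ltr0n //; lra.
Qed.

(** Moving [x] slightly towards the centroid [g] stays in [U] and makes every barycentric weight
    positive. *)
Lemma open_meet_ohull A B C (U : set (R * R)) x : open U -> U x ->
  hull [:: A; B; C] x -> U `&` ohull [:: A; B; C] !=set0.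
Proof.
move=> oU Ux /hull3P[[[a b] c]/= [a0 b0 c0 s1 xE]].
pose g := 3^-1 *: A + 3^-1 *: B + 3^-1 *: C.
have cy : (fun t : R => x + t *: (g - x)) @ 0^'+ --> x.
  rewrite -[X in _ --> X](_ : x + 0 *: (g - x) = x); last by rewrite scale0r addr0.
  apply: cvg_at_right_filter; apply: cvgD; first exact: cvg_cst.
  by apply: cvgZ; [exact: cvg_id|exact: cvg_cst].
have [t [[Ut t0] t1]] : exists t : R, (U (x + t *: (g - x)) /\ 0 < t) /\ t < 1.
  apply: (@filter_ex _ (0^'+)); apply: filterI; last exact: nbhs_right_lt.
  apply: filterI; last exact: nbhs_right_gt.
  by apply: cy; exact: open_nbhs_nbhs.
exists (x + t *: (g - x)); split=> //; apply/ohull3P.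
exists ((1 - t) * a + t / 3, (1 - t) * b + t / 3, (1 - t) * c + t / 3).
have p (y : R) : 0 <= y -> 0 < (1 - t) * y + t / 3.
  move=> y0; apply: ltr_wpDl; first by rewrite mulr_ge0 // subr_ge0 ltW.
  by rewrite divr_gt0 // ltr0n.
split=> /=; [exact: p|exact: p|exact: p| |].
  transitivity ((1 - t) * (a + b + c) + t); first by field.
  by rewrite s1; ring.
rewrite xE /g !pairE /=; congr (_, _); by field.
Qed.

End plane_geometry.

(** * Lebesgue measure of the plane *)

Section plane_measure.
Variable R : realType.
Notation plane := (measurableTypeR R * measurableTypeR R)%type.

Definition box (a b c d : R) : set (R * R) := [set` `]a, b[] `*` [set` `]c, d[].

Lemma measurable_box a b c d : measurable (box a b c d : set plane).
Proof. by apply: measurableX; exact: measurable_itv. Qed.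

Lemma open_box_sub (U : set (R * R)) x : open U -> U x ->
  exists2 e : R, 0 < e & box (x.1 - e) (x.1 + e) (x.2 - e) (x.2 + e) `<=` U.
Proof.
move=> oU Ux; have /nbhs_ballP[e /= e0 eU] : nbhs x U by exact: open_nbhs_nbhs.
exists e => // y [/= y1 y2]; apply: eU; move: y1 y2.
by rewrite !in_itv /= => y1 y2; split; rewrite /ball /= distrC ltr_distl.
Qed.

(** Measurability refers to the product sigma-algebra; an open set belongs to it as a countable
    union of boxes with rational corners. *)
Lemma open_measurable_plane (U : set (R * R)) : open U -> measurable (U : set plane).
Proof.
move=> oU.
pose Q : Type := ((rat * rat) * (rat * rat))%type.
pose B (q : Q) := box (ratr q.1.1) (ratr q.1.2) (ratr q.2.1) (ratr q.2.2).
rewrite (_ : U = \bigcup_(q : Q) if pselect (B q `<=` U) then B q else set0).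
  apply: (@countable_bigcupT_measurable _ _ Q); first exact: countableP.
  by move=> q; case: pselect => ?; [exact: measurable_box|exact: measurable0].
apply/seteqP; split=> [x Ux|x [q _]]; last by case: pselect => //= BU Bx; exact: BU.
have [e e0 eU] := open_box_sub U x oU Ux.
have r y : exists2 q : rat * rat, y \in `](ratr q.1), (ratr q.2)[ & y - e < ratr q.1 /\ ratr q.2 < y + e.
  have [a] := rat_in_itvoo (x := y - e) (y := y) ltac:(lra).
  have [b] := rat_in_itvoo (x := y) (y := y + e) ltac:(lra).
  by rewrite !in_itv /= => /andP[b1 b2] /andP[a1 a2]; exists (a, b); rewrite ?in_itv /= ?a2 ?b1.
have [q1 x1 [a1 b1]] := r x.1; have [q2 x2 [a2 b2]] := r x.2.
exists (q1, q2) => //; have BU : B (q1, q2) `<=` U.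
  move=> y [/=]; rewrite !in_itv /= => /andP[y1 y2] /andP[y3 y4]; apply: eU.
  by split; rewrite /= in_itv /=; apply/andP; split; lra.
by case: pselect => // ?; split.
Qed.

Lemma leb2_box (a b c d : R) : a < b -> c < d ->
  leb2 R (box a b c d) = ((b - a) * (d - c))%:E.
Proof.
move=> ab cd; transitivity (lebesgue_measure (`]a, b[%classic : set R) * lebesgue_measure (`]c, d[%classic : set R))%E.
  by apply: product_measure1E; exact: measurable_itv.
by rewrite !lebesgue_measure_itv /= !lte_fin ab cd.
Qed.

Lemma leb2_open_gt0 (U : set (R * R)) : open U -> U !=set0 -> (0 < leb2 R U)%E.
Proof.
move=> oU [x Ux]; have [e e0 eU] := open_box_sub U x oU Ux.
apply: (@lt_le_trans _ _ (leb2 R (box (x.1 - e) (x.1 + e) (x.2 - e) (x.2 + e)))).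
  by rewrite leb2_box; [rewrite lte_fin mulr_gt0 //; lra|lra|lra].
by apply: le_measure => //; rewrite inE; [exact: measurable_box|exact: open_measurable_plane].
Qed.

Lemma negligible_open (U : set (R * R)) : open U -> (leb2 R).-negligible U -> U = set0.
Proof.
move=> oU [B [mB B0 UB]]; have [//|/set0P U0] := eqVneq U set0.
have : (leb2 R U <= leb2 R B)%E.
  by apply: le_measure => //; rewrite inE //; exact: open_measurable_plane.
by rewrite [X in (_ <= X)%E]B0 leNgt leb2_open_gt0.
Qed.

Lemma bounded_plane (U : set (R * R)) : bounded_set U ->
  exists2 r : R, 0 < r & forall x, U x -> `|x.1| < r /\ `|x.2| < r.
Proof.
move=> [M [_ MU]]; exists (`|M| + 2); first by have := normr_ge0 M; lra.
move=> x Ux; have M1 : M < `|M| + 1 by have := ler_norm M; lra.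
have : `|x| <= `|M| + 1 by exact: MU M1 x Ux.
by rewrite prod_normE ge_max => /andP[? ?]; split; lra.
Qed.

Lemma leb2_bounded (U : set (R * R)) : open U -> bounded_set U -> (leb2 R U < +oo)%E.
Proof.
move=> oU /bounded_plane[r r0 Ur].
apply: (@le_lt_trans _ _ (leb2 R (box (- r) r (- r) r))); last first.
  by rewrite leb2_box ?ltry //; lra.
apply: le_measure; rewrite ?inE; [exact: open_measurable_plane|exact: measurable_box|].
by move=> x /Ur[]; rewrite !ltr_norml => x1 x2; split; rewrite /= in_itv.
Qed.

(** * Integrands on a bounded open domain *)

Section bounded_measurable.
Variable Om : set (R * R).
Hypotheses (oOm : open Om) (bOm : bounded_set Om).

(** This class is stable under sums and products, and its members are integrable because the domain
    has finite measure. It serves every integrand of the scheme except the load, where [f] is only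
    square integrable. *)
Definition bounded_measurable (g : R * R -> R) :=
  measurable_fun (Om : set plane) (g : plane -> measurableTypeR R) /\
  exists C : R, forall x, Om x -> `|g x| <= C.

Lemma bm_cst (c : R) : bounded_measurable (fun=> c).
Proof. by split; [exact: measurable_cst|exists `|c|]. Qed.

Lemma bm_add g h : bounded_measurable g -> bounded_measurable h ->
  bounded_measurable (fun x => g x + h x).
Proof.
move=> [mg [C gC]] [mh [D hD]]; split; first exact: measurable_funD.
by exists (C + D) => x Ox; rewrite (le_trans (ler_normD _ _)) // lerD ?gC ?hD.
Qed.

Lemma bm_mul g h : bounded_measurable g -> bounded_measurable h ->
  bounded_measurable (fun x => g x * h x).
Proof.
move=> [mg [C gC]] [mh [D hD]]; split; first exact: measurable_funM.
by exists (C * D) => x Ox; rewrite normrM ler_pM ?gC ?hD.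
Qed.

Lemma bm_sum (I : finType) (P : pred I) (g : I -> R * R -> R) :
  (forall i, P i -> bounded_measurable (g i)) ->
  bounded_measurable (fun x => \sum_(i | P i) g i x).
Proof.
move=> gi; rewrite (_ : (fun x => _) = \sum_(i | P i) g i); last first.
  by apply/funext => x; rewrite fct_sumE.
elim/big_ind : _ => //; first exact: bm_cst.
by move=> *; exact: bm_add.
Qed.

Lemma bm_indic (U : set (R * R)) : open U -> bounded_measurable (\1_U : R * R -> R).
Proof.
move=> oU; split; first by apply: measurable_indic; exact: open_measurable_plane.
by exists 1 => x _; rewrite indicE; case: (_ \in _); rewrite ?normr1 ?normr0.
Qed.

Lemma bm_affine A B C (a b c : R) : bounded_measurable (affine A B C a b c).
Proof.
have [r _ Or] := bounded_plane _ bOm.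
have b1 : bounded_measurable fst.
  split; first by apply: measurable_funTS; exact: (@measurable_fst _ _ (measurableTypeR R) (measurableTypeR R)).
  by exists r => x /Or[? _]; exact/ltW.
have b2 : bounded_measurable snd.
  split; first by apply: measurable_funTS; exact: (@measurable_snd _ _ (measurableTypeR R) (measurableTypeR R)).
  by exists r => x /Or[_ ?]; exact/ltW.
rewrite (_ : affine A B C a b c = fun x => affine A B C a b c 0 +
  (a * (B.2 - C.2) + b * (C.2 - A.2) + c * (A.2 - B.2)) / det2 (B - A) (C - A) * x.1 +
  (a * (C.1 - B.1) + b * (A.1 - C.1) + c * (B.1 - A.1)) / det2 (B - A) (C - A) * x.2); last first.
  by apply/funext => y; exact: affineE.
apply: bm_add; last by apply: bm_mul => //; exact: bm_cst.
by apply: bm_add; [exact: bm_cst|apply: bm_mul => //; exact: bm_cst].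
Qed.

Lemma bm_near g : bounded_measurable g -> [bounded g x | x in (Om : set plane)].
Proof. by move=> [_ [C gC]]; exists C; split=> [|M CM x /gC /le_trans]; [exact: num_real|apply; exact: ltW]. Qed.

Lemma bm_integrable g : bounded_measurable g ->
  (leb2 R).-integrable (Om : set plane) (EFin \o g).
Proof.
move=> bg; apply: measurable_bounded_integrable.
- exact: open_measurable_plane.
- exact: leb2_bounded.
- exact: bg.1.
- exact: bm_near.
Qed.

Lemma integrable_mul_bm (f g : R * R -> R) : bounded_measurable g ->
  (leb2 R).-integrable (Om : set plane) (EFin \o f) ->
  (leb2 R).-integrable (Om : set plane) (EFin \o (fun x => f x * g x)).
Proof.
move=> bg fi.
have := integrableMl (open_measurable_plane _ oOm) fi bg.1 (bm_near _ bg).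
by apply: eq_integrable => //; exact: open_measurable_plane.
Qed.

Lemma Rintegral_lin (k : R) (f g : R * R -> R) :
  (leb2 R).-integrable (Om : set plane) (EFin \o f) ->
  (leb2 R).-integrable (Om : set plane) (EFin \o g) ->
  \int[leb2 R]_(x in Om) (k * f x + g x) =
  k * \int[leb2 R]_(x in Om) f x + \int[leb2 R]_(x in Om) g x.
Proof.
have mOm := open_measurable_plane _ oOm.
move=> fi gi; rewrite RintegralD //; first by rewrite RintegralZl.
by have := integrableZl mOm k fi; apply: eq_integrable.
Qed.

Lemma Lfun2_integrable (f : R * R -> R) : (f \_ Om) \in Lfun (leb2 R) 2%:E ->
  (leb2 R).-integrable (Om : set plane) (EFin \o f).
Proof.
have mOm := open_measurable_plane _ oOm.
move=> f2; have mf : measurable_fun (Om : set plane) (f : plane -> measurableTypeR R).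
  have : measurable_fun (Om : set plane) (f \_ Om : plane -> measurableTypeR R).
    apply: measurable_funTS; move: f2; rewrite inE => /andP[+ _].
    by rewrite inE.
  by apply: eq_measurable_fun => x xO; rewrite patchE xO.
(* On a domain of finite measure the elementary bound of [|f|] by [1 + f ^+ 2] takes the place of
   the Cauchy-Schwarz inequality. *)
apply: (@le_integrable _ _ _ _ _ mOm _ (fun x => (1 + (f \_ Om) x ^+ 2)%:E)).
- exact/measurable_EFinP.
- move=> x Ox; rewrite /= lee_fin patchE mem_set //.
  rewrite [leRHS]ger0_norm ?addr_ge0 ?sqr_ge0 // -(real_normK (num_real (f x))).
  have := sqr_ge0 (1 - `|f x|); have := sqr_ge0 (`|f x|); rewrite !expr2; lra.
- have i1 := bm_integrable _ (bm_cst 1).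
  have i2 := integrableS measurableT mOm (@subsetT _ _) (Lfun2_integrable_sqr f2).
  by have := integrableD mOm i1 i2; apply: eq_integrable.
Qed.

Lemma Rintegral_eq0_open g (U : set (R * R)) : bounded_measurable g ->
  (forall x, Om x -> 0 <= g x) -> \int[leb2 R]_(x in Om) g x = 0 ->
  open U -> U !=set0 -> U `<=` Om -> exists2 x, U x & g x = 0.
Proof.
have mOm := open_measurable_plane _ oOm.
move=> bg g0 ig0 oU [x Ux] UO.
have gi := bm_integrable _ bg.
have /eqP : (\int[leb2 R]_(x in Om) `|(EFin \o g) x|)%E = 0%E.
  rewrite (eq_integral (fun x : plane => (g x)%:E)); last first.
    by move=> y; rewrite inE => Oy /=; rewrite ger0_norm // g0.
  by rewrite -(fineK (integrable_fin_num mOm gi)); congr (_%:E).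
have mg : measurable_fun (Om : set plane) (fun x : plane => (g x)%:E).
  by apply/measurable_EFinP; exact: bg.1.
move=> /eqP /(ae_eq_integral_abs _ mOm mg) [B [mB B0 sB]].
apply: contrapT => H.
have : U = set0; last by move=> E; rewrite E in Ux.
apply: negligible_open => //; exists B; split=> // y Uy.
apply: sB => /= /(_ (UO _ Uy)) [E]; apply: H; by exists y.
Qed.

Lemma ae_open (P : R * R -> Prop) : open (Om `&` [set x | ~ P x]) ->
  {ae leb2 R, forall x : plane, Om x -> P x} -> forall x, Om x -> P x.
Proof.
move=> oP [B [mB B0 sB]] x Ox; apply: contrapT => Px.
have : (Om `&` [set x | ~ P x]) x by [].
rewrite (negligible_open _ oP) //; exists B; split=> // y [Oy Py].
by apply: sB => /= /(_ Oy).
Qed.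

Lemma enorm_le x : enorm x <= `|x.1| + `|x.2| :> R.
Proof.
rewrite /enorm -(ger0_norm (addr_ge0 (normr_ge0 x.1) (normr_ge0 x.2))) -sqrtr_sqr.
rewrite ler_wsqrtr // /dot -!expr2 -(real_normK (num_real x.1)) -(real_normK (num_real x.2)).
rewrite sqrrD; have := mulr_ge0 (normr_ge0 x.1) (normr_ge0 x.2); lra.
Qed.

Variables (mu : R * R -> R) (Lam : R).
Hypothesis hLip : forall x y, closure Om x -> closure Om y ->
  `|mu x - mu y| <= Lam * enorm (x - y).

Lemma lipschitz_open (V : set R) : open V -> open (Om `&` [set x | V (mu x)]).
Proof.
move=> oV; rewrite openE => x [Ox Vx].
have : nbhs (mu x) V by exact: open_nbhs_nbhs.
move=> /nbhs_ballP[e /= e0 eV].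
have L1 : 0 < `|Lam| + 1 by have := normr_ge0 Lam; lra.
(* Adding [1] keeps the denominator positive when [Lam] is [0]. The factor [2] appears because
   [enorm] is bounded by the sum of two coordinates, while [ball] refers to the sup norm. *)
have d0 : 0 < e / (2 * (`|Lam| + 1)) by rewrite divr_gt0 // mulr_gt0.
have nb : nbhs x (ball x (e / (2 * (`|Lam| + 1)))) by exact: nbhsx_ballx.
have nO : nbhs x Om by exact: open_nbhs_nbhs.
rewrite /interior; near=> y.
have Oy : Om y by near: y; exact: nO.
have by' : ball x (e / (2 * (`|Lam| + 1))) y by near: y; exact: nb.
split=> //=; apply: eV; rewrite /ball /=.
have cl := @subset_closure _ Om.
have H := hLip _ _ (cl _ Ox) (cl _ Oy).
move: by' => []; rewrite /ball /= => b1 b2.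
have H2 := enorm_le (x - y).
have : enorm (x - y) < e / (`|Lam| + 1).
  rewrite (le_lt_trans H2) //.
  have -> : e / (`|Lam| + 1) = e / (2 * (`|Lam| + 1)) + e / (2 * (`|Lam| + 1)).
    by field; rewrite gt_eqF.
  by rewrite ltrD.
rewrite ltr_pdivlMr // => H3; apply: (le_lt_trans H); apply: le_lt_trans H3.
rewrite mulrC ler_wpM2l // ?sqrtr_ge0 //; have := ler_norm Lam; lra.
Unshelve. all: by end_near.
Qed.

Lemma lipschitz_ae_bounds (lo hi : R) :
  {ae leb2 R, forall x : plane, Om x -> lo <= mu x <= hi} ->
  forall x, Om x -> lo <= mu x <= hi.
Proof.
apply: ae_open.
rewrite (_ : _ `&` _ = (Om `&` [set x | (~` [set` `[lo, hi]]) (mu x)])).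
  by apply: lipschitz_open; apply: closed_openC; exact: itv_closed.
by apply/seteqP; split=> x /=; rewrite in_itv.
Qed.

(** Within the domain the preimage of an open interval is open, and open intervals generate the
    Borel sets. *)
Lemma bm_lipschitz (lo hi : R) :
  (forall x, Om x -> lo <= mu x <= hi) -> bounded_measurable mu.
Proof.
move=> b; split; last first.
  exists (`|lo| + `|hi|) => x /b /andP[l h]; rewrite ler_norml; apply/andP; split.
    have := ler_norm (- lo); have := normr_ge0 hi; rewrite normrN; lra.
  by have := ler_norm hi; have := normr_ge0 lo; lra.
apply: (measurability (@RGenOpens.G R)); first exact: RGenOpens.measurableE.
move=> _ [_ [a [c ->]] <-]; apply: open_measurable_plane.
by apply: lipschitz_open; exact: itv_open.
Qed.

End bounded_measurable.
End plane_measure.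

(** * Geometry of the mesh *)

Section hulls.
Variable R : realType.
Implicit Types (A B C x y : R * R).

Lemma hull_baryP A B C x : area A B C != 0 ->
  hull [:: A; B; C] x <->
  [/\ 0 <= affine A B C 1 0 0 x, 0 <= affine A B C 0 1 0 x & 0 <= affine A B C 0 0 1 x].
Proof.
rewrite area_neq0 => D0; rewrite hull3P; split.
  move=> [[[a b] c]/= [a0 b0 c0 s1 ->]]; rewrite !affine_bary //.
  by rewrite !mul0r !mul1r !add0r !addr0.
move=> [a0 b0 c0].
exists (affine A B C 1 0 0 x, affine A B C 0 1 0 x, affine A B C 0 0 1 x).
by split=> //=; [exact: affine_sum1|exact: bary_affine].
Qed.

Lemma closed_hull A B C : area A B C != 0 -> closed (hull [:: A; B; C]).
Proof.
move=> D0; rewrite (_ : hull _ = affine A B C 1 0 0 @^-1` [set r | 0 <= r] `&`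
  (affine A B C 0 1 0 @^-1` [set r | 0 <= r] `&` affine A B C 0 0 1 @^-1` [set r | 0 <= r])).
  by apply: closedI; [|apply: closedI]; apply: closed_comp;
    do ?[exact: closed_ge|by move=> ? _; exact: continuous_affine].
by apply/seteqP; split=> x /=; rewrite hull_baryP //; [case|case=> ? []].
Qed.

Lemma hull_nil x : ~ hull [::] x.
Proof. by move=> [w [_ /eqP]]; rewrite big_ord0 eq_sym oner_eq0. Qed.

Lemma hull3_bounded A B C x : hull [:: A; B; C] x ->
  `|x.1| <= `|A.1| + `|B.1| + `|C.1| /\ `|x.2| <= `|A.2| + `|B.2| + `|C.2|.
Proof.
move=> /hull3P[[[a b] c]/= [a0 b0 c0 s1 ->]].
have H (p q r : R) : `|a * p + b * q + c * r| <= `|p| + `|q| + `|r|.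
  rewrite (le_trans (ler_normD _ _)) // lerD //.
    rewrite (le_trans (ler_normD _ _)) // lerD // normrM ger0_norm // ler_piMl //; lra.
  by rewrite normrM ger0_norm // ler_piMl //; lra.
by rewrite !pairE /=; split; exact: H.
Qed.

(** On the horizontal line through a point of [S], the supremum of the abscissas lying in [S] gives
    a point of the closure. It is not in [S], since openness would then allow a larger abscissa. *)
Lemma frontier_neq0 (S : set (R * R)) : open S -> S !=set0 -> bounded_set S ->
  frontier S !=set0.
Proof.
move=> oS [p Sp] /bounded_plane[r r0 Sr].
pose f (t : R) : R * R := (t, p.2).
have cf : continuous f.
  move=> t; apply: (@cvg_pair _ _ _ (nbhs t) (nbhs t) (nbhs p.2) _ _ _ id (cst p.2)).
    exact: cvg_id.
  exact: cvg_cst.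
pose A := f @^-1` S.
have A0 : A !=set0 by exists p.1; rewrite /A /f /= -surjective_pairing.
have Ab : has_ubound A.
  by exists r => t /Sr[/=]; rewrite ltr_norml => /andP[_ /ltW].
exists (f (sup A)); split.
  move=> V nV; have [t [At Vt]] := closure_sup A0 Ab (cf _ _ nV).
  by exists (f t).
move=> /interior_subset Sf; have nA : nbhs (sup A) A.
  by apply: open_nbhs_nbhs; split=> //; apply: open_comp.
have [t [At ht]] : exists t, A t /\ sup A < t.
  apply: (@filter_ex _ ((sup A)^'+)); apply: filterI; last exact: nbhs_right_gt.
  exact: cvg_within nA.
by have := ub_le_sup Ab At; rewrite leNgt ht.
Qed.

Lemma enorm_gt0 x : x != 0 -> 0 < enorm x.
Proof.
move=> x0; rewrite /enorm sqrtr_gt0 /dot -!expr2 lt_neqAle addr_ge0 ?sqr_ge0 // andbT.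
rewrite eq_sym paddr_eq0 ?sqr_ge0 // !sqrf_eq0; apply: contra x0 => /andP[/eqP a /eqP b].
by rewrite [x]surjective_pairing a b.
Qed.

Lemma diam_gt0 A B C : area A B C != 0 -> 0 < diam (hull [:: A; B; C]).
Proof.
move=> D0; have AB : A != B by apply: contraNneq D0 => ->; rewrite area_AA.
have hA : hull [:: A; B; C] A.
  apply/hull3P; exists (1, 0, 0); split=> //=; first by rewrite !addr0.
  by rewrite scale1r !scale0r !addr0.
have hB : hull [:: A; B; C] B.
  apply/hull3P; exists (0, 1, 0); split=> //=; first by rewrite add0r addr0.
  by rewrite scale1r !scale0r add0r addr0.
apply: (lt_le_trans (enorm_gt0 (A - B) _)); first by rewrite subr_eq0.
rewrite /diam; apply: ub_le_sup; last by exists A => //; exists B.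
(* An upper bound must be exhibited for [sup] to dominate the distance from [A] to [B]. *)
exists ((`|A.1| + `|B.1| + `|C.1| + (`|A.1| + `|B.1| + `|C.1|)) +
        (`|A.2| + `|B.2| + `|C.2| + (`|A.2| + `|B.2| + `|C.2|))).
move=> _ [x /hull3_bounded[x1 x2] [y /hull3_bounded[y1 y2] <-]].
apply: (le_trans (enorm_le _ _)); apply: lerD.
  by rewrite (le_trans (ler_normB _ _)) // lerD.
by rewrite (le_trans (ler_normB _ _)) // lerD.
Qed.

End hulls.

Section mesh_geometry.
Variables (R : realType) (Om : set (R * R)) (M : mesh Om).
Hypothesis hOm : polygonal_domain Om.
Implicit Types (e : edgeI M) (v : vertI M) (K L : cellI M).

(** Gives interior and boundary triangles a common shape, so that the lemmas on triangles apply to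
    both at once. *)
Definition third e : R * R := if eopp e is Some L then xcell L else xedge e.

Lemma triE e v : tri e v = [:: xvert v; xcell (ecell e); third e].
Proof. by rewrite /tri /third; case: (eopp e). Qed.

Lemma eside_ecell e : eside e (ecell e).
Proof. by rewrite /eside eqxx. Qed.

Lemma eside_opp e L : eopp e = Some L -> eside e L.
Proof. by rewrite /eside => ->; rewrite eqxx orbT. Qed.

Lemma area_tri e v : eend e v -> area (xvert v) (xcell (ecell e)) (third e) != 0.
Proof.
move=> ev; rewrite /third; case eo: (eopp e) => [L|].
  exact: tri_nondeg ev eo.
exact: subtri_nondeg (eside_ecell e) ev.
Qed.

Lemma eend_src e : eend e (esrc e).
Proof. by rewrite /eend eqxx. Qed.

(** If the point of the edge were one of the two mesh points, the sub-triangle on that side would be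
    flat. *)
Lemma xedge_between e L : eopp e = Some L -> exists2 t : R, 0 < t < 1 &
  xedge e = (1 - t) *: xcell (ecell e) + t *: xcell L.
Proof.
move=> eo; have : [set xedge e] (xedge e) by [].
rewrite -(xedge_int eo) => -[/hull2P[t /andP[t0 t1] E] _].
exists t => //; rewrite !lt_neqAle t0 t1 !andbT eq_sym.
apply/andP; split.
  apply/negP => /eqP t00; have := subtri_nondeg (eside_ecell e) (eend_src e).
  by rewrite E t00 subr0 scale1r scale0r addr0 area_BB eqxx.
apply/negP => /eqP t11; have := subtri_nondeg (eside_opp _ _ eo) (eend_src e).
by rewrite E t11 subrr scale1r scale0r add0r area_BB eqxx.
Qed.

(** For an interior edge the weight [c] of [xedge e] is shared between the two mesh points as
    [c * (1 - t)] and [c * t], and all weights stay positive. For a boundary edge the two triangles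
    coincide. *)
Lemma sub_in_tri K e v : is_sub (K, e, v) -> sub (K, e, v) `<=` ohull (tri e v).
Proof.
rewrite /is_sub /= => /andP[eK ev] x; rewrite /sub triE /third /=.
move: eK; rewrite /eside; case eo: (eopp e) => [L|]; last by rewrite orbF => /eqP->.
have [t /andP[t0 t1] ->] := xedge_between _ _ eo.
move=> eK /ohull3P[[[a b] c]/= [a0 b0 c0 s1 ->]]; apply/ohull3P.
have c1 : 0 < c * t by rewrite mulr_gt0.
have c2 : 0 < c * (1 - t) by rewrite mulr_gt0 // subr_gt0.
case/orP: eK => [/eqP <-|/eqP[<-]].
- exists (a, b + c * (1 - t), c * t); split=> //=; [lra|lra|].
  by rewrite !pairE /=; congr (_, _); ring.
- exists (a, c * (1 - t), b + c * t); split=> //=; [lra|lra|].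
  by rewrite !pairE /=; congr (_, _); ring.
Qed.

(* The point of an interior edge lies strictly between the two mesh points, so
   a common point of the two sub-triangles would get two different barycentric
   coordinates in the triangle. *)
Lemma sub_opp_disjoint e v L : eend e v -> eopp e = Some L ->
  sub (ecell e, e, v) `&` sub (L, e, v) = set0.
Proof.
move=> ev eo; apply/seteqP; split=> // x []; rewrite /sub /=.
have [t /andP[t0 t1] ->] := xedge_between _ _ eo.
move=> /ohull3P[[[a b] c]/= [a0 b0 c0 s1 E]].
move=> /ohull3P[[[a' b'] c']/= [a0' b0' c0' s1' E']].
have D0 : det2 (xcell (ecell e) - xvert v) (xcell L - xvert v) != 0.
  by rewrite -area_neq0; exact: tri_nondeg ev eo.
have F1 : x = a *: xvert v + (b + c * (1 - t)) *: xcell (ecell e) + (c * t) *: xcell L.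
  by rewrite E !pairE /=; congr (_, _); ring.
have F2 : x = a' *: xvert v + (c' * (1 - t)) *: xcell (ecell e) + (b' + c' * t) *: xcell L.
  by rewrite E' !pairE /=; congr (_, _); ring.
have S1 : a + (b + c * (1 - t)) + c * t = 1 by lra.
have S2 : a' + c' * (1 - t) + (b' + c' * t) = 1 by lra.
have G1 := affine_bary _ _ _ _ 0 1 0 _ _ _ D0 S1.
have G2 := affine_bary _ _ _ _ 0 1 0 _ _ _ D0 S2.
have H1 := affine_bary _ _ _ _ 0 0 1 _ _ _ D0 S1.
have H2 := affine_bary _ _ _ _ 0 0 1 _ _ _ D0 S2.
rewrite -F1 in G1 H1; rewrite -F2 in G2 H2.
have P1 : b = (c' - c) * (1 - t) by lra.
have P2 : b' = (c - c') * t by lra.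
have Q1 : 0 < (c' - c) * (1 - t) by rewrite -P1.
have Q2 : 0 < (c - c') * t by rewrite -P2.
by move: Q1 Q2; rewrite pmulr_lgt0 ?subr_gt0 // pmulr_lgt0 // subr_gt0; lra.
Qed.

(** Different pairs [(e, v)] place the sub-triangles in disjoint triangles of the third mesh; with
    the same pair they are the two halves of one triangle. *)
Lemma sub_disjoint (t t' : cellI M * edgeI M * vertI M) : is_sub t -> is_sub t' -> t != t' ->
  sub t `&` (sub t' : set (R * R)) = set0 :> set (R * R).
Proof.
move: t t' => [[K e] v] [[K' e'] v'] it it' ne.
have /andP[/= eK ev] := it; have /andP[/= eK' ev'] := it'.
have [[? ?]|nev] := eqVneq (e, v) (e', v'); last first.
  apply/seteqP; split=> // x [/(sub_in_tri _ _ _ it) h1 /(sub_in_tri _ _ _ it') h2].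
  by rewrite -(tri_disjoint ev ev' nev).
subst e' v'; move: eK eK'; rewrite /eside; case eo: (eopp e) => [L|]; last first.
  by rewrite !orbF => /eqP E /eqP E'; rewrite -E -E' eqxx in ne.
case/orP=> [/eqP E|/eqP[E]] /orP[/eqP E'|/eqP[E']]; rewrite -?E -?E' ?eqxx // in ne *.
  exact: sub_opp_disjoint.
by rewrite setIC; exact: sub_opp_disjoint.
Qed.

Lemma open_sub (t : cellI M * edgeI M * vertI M) : is_sub t -> open (sub t : set (R * R)).
Proof. by case: t => [[K e] v] /andP[/= ? ?]; apply: open_ohull; exact: subtri_nondeg. Qed.

Lemma open_tri e v : eend e v -> open (ohull (tri e v)).
Proof. by move=> ev; rewrite triE; apply: open_ohull; exact: area_tri. Qed.

Lemma tri_sub_closure e v : eend e v -> hull (tri e v) `<=` closure Om.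
Proof. by move=> ev x hx; rewrite (tri_cover M); exists (e, v). Qed.

Lemma open_meet_domain (U : set (R * R)) : open U -> U !=set0 -> U `<=` closure Om ->
  U `&` Om !=set0.
Proof.
move=> oU [x Ux] UO; have [y [Oy Uy]] := UO x Ux U (open_nbhs_nbhs (conj oU Ux)).
by exists y.
Qed.

Lemma sub_meet_domain (t : cellI M * edgeI M * vertI M) : is_sub t -> (sub t : set (R * R)) `&` Om !=set0.
Proof.
move: t => [[K e] v] it; apply: open_meet_domain; first exact: open_sub.
  exact: ohull3_neq0.
move=> x /(sub_in_tri _ _ _ it)/ohull_sub_hull; apply: tri_sub_closure.
by case/andP: it.
Qed.

Lemma open_dual_cell v : open (dual_cell v : set (R * R)).
Proof. exact: open_interior. Qed.

Lemma dual_cell_meet_domain v : (dual_cell v : set (R * R)) `&` Om !=set0.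
Proof.
have [e ev] := vert_end v.
have [x [tx Ox]] : ohull (tri e v) `&` Om !=set0.
  apply: open_meet_domain; first exact: open_tri.
    by rewrite triE; exact: ohull3_neq0.
  by move=> x /ohull_sub_hull; exact: tri_sub_closure.
exists x; split=> //; rewrite /dual_cell /interior /=.
apply: (filterS _ (open_nbhs_nbhs (conj (open_tri _ _ ev) tx))).
by move=> y /ohull_sub_hull ty; exists e.
Qed.

(** [tri_disjoint] concerns open triangles, whereas dual cells come from closed ones. A common point
    is therefore perturbed twice: into an open triangle at [v] while staying in the other dual cell,
    then into an open triangle at [v'] while staying in the first one. *)
Lemma dual_cell_disjoint v v' : v != v' ->
  dual_cell v `&` (dual_cell v' : set (R * R)) = set0 :> set (R * R).
Proof.
move=> vv; apply/seteqP; split=> // x [xv xv'].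
have [e /= ev hx] := interior_subset xv.
have oU : open (dual_cell v' : set (R * R)) := open_dual_cell v'.
have [y [yU yt]] : (dual_cell v' `&` ohull (tri e v)) !=set0.
  by rewrite triE in hx *; exact: open_meet_ohull _ _ _ _ _ oU xv' hx.
have [e' /= ev' hy] := interior_subset yU.
have [z [zt zt']] : (ohull (tri e v) `&` ohull (tri e' v')) !=set0.
  by rewrite (triE e') in hy *; exact: open_meet_ohull _ _ _ _ _ (open_tri _ _ ev) yt hy.
have : (e, v) != (e', v') by rewrite xpair_eqE negb_and vv orbT.
by move=> /(tri_disjoint ev ev') E; have : set0 z by rewrite -E.
Qed.

Lemma frontier_open_notin (S : set (R * R)) x : open S -> frontier S x -> ~ S x.
Proof. by move=> oS [_ nS] Sx; apply: nS; exact: open_nbhs_nbhs. Qed.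

Lemma domain_frontier_neq0 (S : set (R * R)) : polygonal_domain S -> frontier S !=set0.
Proof. by case=> *; exact: frontier_neq0. Qed.

Lemma open_cell K : open (cell K).
Proof. by case: (cell_polygonal K). Qed.

Lemma cell_edge K : exists e, eside e K.
Proof.
have [x] := domain_frontier_neq0 (cell K) (cell_polygonal K).
by rewrite cell_frontier => -[e /= eK _]; exists e.
Qed.

Lemma mesh_size_gt0 : 0 < mesh_size M.
Proof.
have [x Ox] : Om !=set0 by case: hOm.
have := subset_closure Ox; rewrite (tri_cover M) => -[[e v] /= ev _].
apply: (lt_le_trans (diam_gt0 _ _ _ _ (area_tri e v ev))); rewrite -triE.
apply: ub_le_sup; last by exists (e, v).
(* There are finitely many triangles, so a sum bounds their diameters; absolute values make the
   other terms non-negative. *)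
exists (\sum_(t : edgeI M * vertI M) `|diam (hull (tri t.1 t.2))|).
move=> _ [t _ <-]; rewrite (bigD1 t) //= (le_trans (ler_norm _)) // lerDl.
exact: sumr_ge0.
Qed.

Lemma xvert_in_eseg e v : eend e v -> hull (eseg e) (xvert v).
Proof.
rewrite /eend /eseg => /orP[/eqP ->|/eqP ->]; apply/hull2P.
  by exists 0; rewrite ?lexx ?ler01 // subr0 scale1r scale0r addr0.
by exists 1; rewrite ?lexx ?ler01 // subrr scale1r scale0r add0r.
Qed.

(** A vertex lies on the frontier of some cell. That cell, being open, does not contain it, and
    neither does an open cell disjoint from it. *)
Lemma xvert_neq_xcell v K : xvert v <> xcell K.
Proof.
have [e ev] := vert_end v => E.
have fv : frontier (cell (ecell e)) (xvert v).
  by rewrite cell_frontier; exists e; [exact: eside_ecell|exact: xvert_in_eseg].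
have cK := xcell_in K; rewrite -E in cK.
have [eK|nK] := eqVneq (ecell e) K.
  by rewrite eK in fv; apply: frontier_open_notin _ _ _ fv cK; exact: open_cell.
have [y [y1 y2]] := fv.1 _ (open_nbhs_nbhs (conj (open_cell K) cK)).
have : (cell (ecell e) `&` cell K) y by [].
by rewrite (cell_disjoint nK).
Qed.

Lemma xcell_inj K L : xcell K = xcell L :> R * R -> K = L.
Proof.
move=> E; have [//|nK] := eqVneq K L.
have : (cell K `&` cell L) (xcell K).
  by split; [exact: xcell_in|rewrite E; exact: xcell_in].
by rewrite (cell_disjoint nK).
Qed.

Lemma frontier_domain_not_xcell K : ~ frontier Om (xcell K).
Proof.
have [oOm _ _ _ _] := hOm => fK; apply: frontier_open_notin _ _ _ fK _ => //.
exact: cell_sub (xcell_in K).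
Qed.

Lemma eend_bnd_frontier e v : eend e v -> eopp e = None -> frontier Om (xvert v).
Proof. by move=> ev /edge_bnd; apply; exact: xvert_in_eseg. Qed.

(** A frontier point of the domain lies on the frontier of a cell, hence on an edge. A boundary edge
    has its ends on the frontier; an interior edge has its relative interior inside the domain, so
    the point is one of its ends. *)
Lemma frontier_domain_vertex : exists v, frontier Om (xvert (m := M) v).
Proof.
have [y fy] := domain_frontier_neq0 Om hOm.
have [oOm _ _ _ _] := hOm.
have ycl : (\bigcup_(K : cellI M) closure (cell K : set (R * R))) y.
  have cl : closed (\bigcup_(K : cellI M) closure (cell K : set (R * R))).
    apply: closed_bigcup; last by move=> *; exact: closed_closure.
    exact: (sub_finite_set _ (finite_finset (X := [set: cellI M]))).
  apply: cl; apply: closure_subset fy.1.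
  exact: (cell_cover M).
have [K _ yK] := ycl.
have : frontier (cell K) y.
  split=> // /interior_subset /cell_sub Oy; exact: frontier_open_notin _ _ oOm fy Oy.
rewrite cell_frontier => -[e /= eK ye].
case eo: (eopp e) => [L|]; last first.
  by exists (esrc e); exact: eend_bnd_frontier _ _ (eend_src e) eo.
have /hull2P[t /andP[t0 t1] yE] := ye.
have [t00|tn0] := eqVneq t 0.
  exists (esrc e); suff <- : y = xvert (esrc e) by [].
  by rewrite yE t00 subr0 scale1r scale0r addr0.
have [t11|tn1] := eqVneq t 1.
  exists (etgt e); suff <- : y = xvert (etgt e) by [].
  by rewrite yE t11 subrr scale1r scale0r add0r.
exfalso; apply: (frontier_open_notin _ _ oOm fy); apply: edge_int eo _ _.
apply: (ohull2P _ _ _ _ _ _ yE); rewrite !lt_neqAle t0 t1 tn1 !andbT eq_sym.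
exact: tn0.
Qed.

(** * Propagation of a constant value through the mesh *)

Section constant_on_triangles.
Variable s : discrete_scalar M.
Hypothesis s_bnd : forall v, frontier Om (xvert v) -> s.2 v = 0.
Hypothesis s_const : forall e v K, eside e K -> eend e v -> s.1 K = s.2 v.

(** Conformity provides a common point of the plane without telling which role it plays in either
    triangle, so values are attached to points. They are well defined because mesh points of cells
    are neither vertices nor frontier points, and frontier vertices carry [0]. *)
Definition vertex_value (x : R * R) (r : R) : Prop :=
  [\/ exists2 v, x = xvert v & r = s.2 v, exists2 K, x = xcell K & r = s.1 K |
      frontier Om x /\ r = 0].

(** For a boundary edge the third vertex is the frontier point [xedge e], with value [0]; the value
    at [v] is also [0], since [v] lies on the frontier. *)
Lemma vertex_value_tri e v x : eend e v -> x \in tri e v -> vertex_value x (s.2 v).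
Proof.
move=> ev; rewrite triE !inE => /or3P[/eqP->|/eqP->|/eqP->].
- by constructor 1; exists v.
- by constructor 2; exists (ecell e) => //; rewrite (s_const e v) ?eside_ecell.
- rewrite /third; case eo: (eopp e) => [L|].
    by constructor 2; exists L => //; rewrite (s_const e v) ?(eside_opp _ _ eo).
  constructor 3; rewrite s_bnd; last exact: eend_bnd_frontier _ _ ev eo.
  by split=> //; apply: (edge_bnd eo); apply: ohull_sub_hull; exact: xedge_bnd.
Qed.

Lemma vertex_value_uniq x r r' : vertex_value x r -> vertex_value x r' -> r = r'.
Proof.
move=> [[v -> ->]|[K -> ->]|[fx ->]] [[w E ->]|[L E ->]|[fy ->]] //.
- by rewrite (xvert_inj E).
- by case: (xvert_neq_xcell _ _ E).
- exact: s_bnd.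
- by case: (xvert_neq_xcell w K); rewrite E.
- by rewrite (xcell_inj _ _ E).
- by case: (frontier_domain_not_xcell K).
- by rewrite s_bnd // -E.
- by case: (frontier_domain_not_xcell L); rewrite -E.
Qed.

Lemma tri_meet_value e v e' v' x : eend e v -> eend e' v' ->
  hull (tri e v) x -> hull (tri e' v') x -> s.2 v = s.2 v'.
Proof.
move=> ev ev' hx hx'.
have : (hull (tri e v) `&` hull (tri e' v')) x by [].
rewrite tri_conform //.
(* The hull of the empty list is empty, so the list of shared vertices has an element. *)
case E: [seq _ <- _ | _] => [|y l]; first by move/hull_nil.
move=> _; have : y \in [seq x <- tri e v | x \in tri e' v'] by rewrite E mem_head.
rewrite mem_filter => /andP[y' y0].
exact: (vertex_value_uniq _ _ _ (vertex_value_tri _ _ _ ev y0) (vertex_value_tri _ _ _ ev' y')).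
Qed.

Lemma constant_vanishes : (forall v, s.2 v = 0) /\ (forall K, s.1 K = 0).
Proof.
suff v0 : forall v, s.2 v = 0.
  by split=> // K; have [e eK] := cell_edge K; rewrite (s_const e (esrc e)) ?eend_src.
have [_ _ cOm _ _] := hOm.
(* Triangles are sorted by whether their value is zero. Both finite unions are closed, so being
   disjoint they are separated, against connectedness of the closure. *)
pose I (b : bool) := [set t : edgeI M * vertI M | eend t.1 t.2 && ((s.2 t.2 == 0) == b)].
pose E b := \bigcup_(t in I b) hull (tri t.1 t.2).
have clE b : closed (E b).
  apply: closed_bigcup.
    exact: (sub_finite_set _ (finite_finset (X := [set: edgeI M * vertI M]))).
  by move=> [e v] /andP[/= ev _]; rewrite triE; apply: closed_hull; exact: area_tri.
have dE : E false `&` E true = set0.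
  apply/seteqP; split=> // x [[[e v] /andP[/= ev /eqP sv] hx] [[e' v'] /andP[/= ev' /eqP sv'] hx']].
  by rewrite (tri_meet_value _ _ _ _ _ ev ev' hx hx') sv' in sv.
have [w fw] := frontier_domain_vertex.
have [e0 ew] := vert_end w.
have mem e v : eend e v -> hull (tri e v) (xvert v).
  move=> ev; rewrite triE; apply/hull3P; exists (1, 0, 0).
  by split=> //=; rewrite ?addr0 // scale1r !scale0r !addr0.
move=> v; apply: contrapT => /eqP nv; have [e ev] := vert_end v.
apply: ((connectedP _).1 (connected_closure cOm) E); split.
- case; [exists (xvert w); exists (e0, w)|exists (xvert v); exists (e, v)] => /=.
  + by rewrite /I /= ew s_bnd // eqxx.
  + exact: mem.
  + by rewrite /I /= ev (negbTE nv).
  + exact: mem.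
- rewrite (tri_cover M); apply/seteqP; split=> [x [[e1 v1] /= ev1 hx]|x].
    by case sv: (s.2 v1 == 0); [right|left]; exists (e1, v1); rewrite // /I /= ev1 sv.
  by case=> [] [[e1 v1] /= /andP[ev1 _] hx]; exists (e1, v1).
- by split; rewrite -((closure_id _).1 (clE _)).
Qed.

End constant_on_triangles.
End mesh_geometry.

(** * The discrete operators and the weak forms *)

Section operators.
Variables (R : realType) (Om : set (R * R)) (M : mesh Om) (mu : R * R -> R).
Hypothesis hM : flux_nondegenerate M mu.
Implicit Types (e : edgeI M) (v : vertI M) (K L : cellI M) (s : discrete_scalar M)
  (u w : discrete_field M).

Definition scalar_comb (k : R) s s' : discrete_scalar M :=
  (fun K => k * s.1 K + s'.1 K, fun v => k * s.2 v + s'.2 v).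

Lemma comp1_lin k u w :
  comp1 (k *: u + w : discrete_field M) = scalar_comb k (comp1 u) (comp1 w).
Proof. by congr (_, _); apply/funext => i; rewrite /= !ffunE. Qed.

Lemma comp2_lin k u w :
  comp2 (k *: u + w : discrete_field M) = scalar_comb k (comp2 u) (comp2 w).
Proof. by congr (_, _); apply/funext => i; rewrite /= !ffunE. Qed.

Lemma dotC (a b : R * R) : dot a b = dot b a.
Proof. by rewrite /dot mulrC [X in _ + X]mulrC. Qed.

Lemma dot_ge0 (a : R * R) : 0 <= dot a a.
Proof. by rewrite /dot -!expr2 addr_ge0 ?sqr_ge0. Qed.

Lemma dot_eq0 (a : R * R) : dot a a = 0 -> a = 0.
Proof.
rewrite /dot -!expr2 => /eqP; rewrite paddr_eq0 ?sqr_ge0 // !sqrf_eq0 => /andP[/eqP a1 /eqP a2].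
by rewrite [a]surjective_pairing a1 a2.
Qed.

Lemma flux_lin k s s' e v K t t' :
  flux mu (scalar_comb k s s') e v K (k * t + t') =
  k * flux mu s e v K t + flux mu s' e v K t'.
Proof.
rewrite /flux /scalar_comb /= affine_grad_lin.
move: (affine_grad _ _ _ _ _ _) (affine_grad _ _ _ _ _ _) => g g'.
move: (average _ _) (onormal _ _ _) => a n.
by rewrite /dot !pairE /=; ring.
Qed.

(** The edge value [t] multiplies the gradient of the barycentric coordinate of [xedge e], which
    [onormalE] turns into a normal over twice the area. The slope is thus the coefficient of the
    non-degeneracy hypothesis. *)
Lemma flux_slope s e v K t : eside e K -> eend e v ->
  flux mu s e v K t = flux mu s e v K 0 -
    average mu (cell K) *
    dot (onormal (xedge e) (xvert v) (xcell K))
        (onormal (xvert v) (xcell K) (xedge e)) /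
    (2 * area (xvert v) (xcell K) (xedge e)) * t.
Proof.
move=> eK ev; have /(onormalE _ _ _) := subtri_nondeg eK ev.
rewrite pair_scaleE => -[E1 E2].
set n := onormal (xvert v) _ _ in E1 E2 *.
set m := onormal (xedge e) _ _; set S := 2 * _ in E1 E2 *.
have -> : average mu (cell K) * dot m n / S * t =
    average mu (cell K) * (m.1 * (S^-1 * n.1) + m.2 * (S^-1 * n.2)) * t.
  by rewrite /dot; ring.
by rewrite E1 E2 /flux -/m /dot !affine_gradE /=; ring.
Qed.

(** The total flux is affine in [t], with the non-zero slope supplied by [hM]; [xget] returns its
    single root. *)
Lemma edge_valueP s e v L t : eend e v -> eopp e = Some L ->
  flux mu s e v (ecell e) t + flux mu s e v L t = 0 <-> t = edge_value mu s e v.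
Proof.
move=> ev eo; have := hM _ _ _ ev eo; rewrite /= => nd.
have E r := conj (flux_slope s e v (ecell e) r (eside_ecell _ _ M e) ev)
                 (flux_slope s e v L r (eside_opp _ _ M e L eo) ev).
set F := fun r => flux mu s e v (ecell e) r + flux mu s e v L r.
have [c [c0 cE]] : exists c, c != 0 /\ forall r, F r = F 0 + c * r.
  eexists; split; first exact: nd.
  by move=> r; rewrite /F (E r).1 (E r).2; ring.
have uniq r r' : F r = 0 -> F r' = 0 -> r = r'.
  rewrite cE [F r']cE => Er Er'; apply: (mulfI c0); lra.
have sol : F (- F 0 / c) = 0 by rewrite cE mulrC mulfVK // addrN.
have -> : edge_value mu s e v = - F 0 / c.
  rewrite /edge_value eo; apply: xget_unique => // y Fy; exact: uniq.
by split=> [Ft|->]; [exact: uniq|exact: sol].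
Qed.

(** The combination of the two edge values solves the combined flux equation, so uniqueness of the
    root gives linearity. *)
Lemma edge_value_lin k s s' e v : eend e v ->
  edge_value mu (scalar_comb k s s') e v =
  k * edge_value mu s e v + edge_value mu s' e v.
Proof.
move=> ev; case eo: (eopp e) => [L|]; last by rewrite /edge_value eo mulr0 addr0.
symmetry; apply/(edge_valueP _ _ _ _ _ ev eo); rewrite !flux_lin.
have E := (edge_valueP s _ _ _ _ ev eo).2 erefl.
have E' := (edge_valueP s' _ _ _ _ ev eo).2 erefl.
move: E E'; move: (flux _ _ _ _ _ _) (flux _ _ _ _ _ _) (flux _ _ _ _ _ _) (flux _ _ _ _ _ _).
by move=> a b c d E E'; rewrite addrACA -mulrDr E E' mulr0 addr0.
Qed.

Lemma dgrad_lin k s s' x : dgrad mu (scalar_comb k s s') x =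
  k *: dgrad mu s x + dgrad mu s' x.
Proof.
rewrite /dgrad scaler_sumr -big_split /=; apply: eq_bigr => t /andP[_ ev].
rewrite edge_value_lin // /scalar_comb /= affine_grad_lin.
move: (affine_grad _ _ _ _ _ _) (affine_grad _ _ _ _ _ _) (\1_ _ _) => g g' i.
by rewrite scalerDr !scalerA mulrC.
Qed.

Lemma P_lin k s s' x : P mu (scalar_comb k s s') x = k * P mu s x + P mu s' x.
Proof.
rewrite /P mulr_sumr -big_split /=; apply: eq_bigr => t /andP[_ ev].
by rewrite edge_value_lin // /scalar_comb /= affine_lin mulrDl mulrA.
Qed.

Lemma dgrad_sub s t x : is_sub t -> sub t x ->
  dgrad mu s x = affine_grad (xvert t.2) (xcell t.1.1) (xedge t.1.2)
      (s.2 t.2) (s.1 t.1.1) (edge_value mu s t.1.2 t.2).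
Proof.
move=> it tx; rewrite /dgrad (bigD1 t) //= big1 ?addr0.
  by rewrite indicE mem_set // scale1r.
move=> t' /andP[it' ne]; rewrite indicE memNset ?scale0r // => tx'.
have : (sub t `&` sub t') x by [].
by rewrite sub_disjoint // eq_sym.
Qed.

(* Unfolding these constants makes unification diverge. *)
Local Opaque dgrad P.

Lemma ddiv_lin k u w x : ddiv mu (k *: u + w : discrete_field M) x =
  k * ddiv mu u x + ddiv mu w x.
Proof.
rewrite /ddiv comp1_lin comp2_lin !dgrad_lin.
move: (dgrad _ _ _) (dgrad _ _ _) (dgrad _ _ _) (dgrad _ _ _) => a b c d.
by rewrite /dot !pairE /=; ring.
Qed.

Lemma ddotC u w x : dgrad_ddot mu u w x = dgrad_ddot mu w u x.
Proof.
rewrite /dgrad_ddot.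
move: (dgrad mu (comp1 u) x) (dgrad mu (comp2 u) x) => a b.
by rewrite (dotC a) (dotC b).
Qed.

Lemma ddot_lin k u u' w x : dgrad_ddot mu (k *: u + u' : discrete_field M) w x =
  k * dgrad_ddot mu u w x + dgrad_ddot mu u' w x.
Proof.
rewrite /dgrad_ddot comp1_lin comp2_lin !dgrad_lin.
move: (dgrad _ (comp1 u) _) (dgrad _ (comp2 u) _) (dgrad _ (comp1 u') _)
  (dgrad _ (comp2 u') _) (dgrad _ (comp1 w) _) (dgrad _ (comp2 w) _).
move=> a b c d g h.
by rewrite /dot !pairE /=; ring.
Qed.

Lemma ddot_ge0 u x : 0 <= dgrad_ddot mu u u x.
Proof. by rewrite /dgrad_ddot addr_ge0 // dot_ge0. Qed.

Lemma ddot_eq0 u x : dgrad_ddot mu u u x = 0 ->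
  dgrad mu (comp1 u) x = 0 /\ dgrad mu (comp2 u) x = 0.
Proof.
rewrite /dgrad_ddot; move: (dgrad mu (comp1 u) x) (dgrad mu (comp2 u) x) => a b /eqP.
by rewrite paddr_eq0 ?dot_ge0 // => /andP[/eqP/dot_eq0 -> /eqP/dot_eq0 ->].
Qed.

End operators.

(** * Well-posedness by the energy method *)

Section weak_forms.
Variables (R : realType) (Om : set (R * R)) (M : mesh Om).
Variables (f : R * R -> R * R) (mu : R * R -> R) (lam_lo lam_hi Lam : R).
Hypotheses (hOm : polygonal_domain Om)
  (hf1 : ((fun x => (f x).1) \_ Om) \in Lfun (leb2 R) 2%:E)
  (hf2 : ((fun x => (f x).2) \_ Om) \in Lfun (leb2 R) 2%:E)
  (hlam_lo : 0 < lam_lo)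
  (hmu : {ae leb2 R, forall x, Om x -> lam_lo <= mu x <= lam_hi})
  (hLip : forall x y, closure Om x -> closure Om y ->
       `|mu x - mu y| <= Lam * enorm (x - y))
  (hM : flux_nondegenerate M mu).
Implicit Types (s : discrete_scalar M) (u v w : discrete_field M) (p q : R * R -> R).

Let oOm : open Om. Proof. by case: hOm. Qed.
Let bOm : bounded_set Om. Proof. by case: hOm. Qed.
Local Notation bm := (bounded_measurable R Om).

Lemma mu_bounds x : Om x -> lam_lo <= mu x <= lam_hi.
Proof. exact: (lipschitz_ae_bounds _ _ oOm _ _ hLip). Qed.

Lemma bm_mu : bm mu.
Proof. exact: (bm_lipschitz _ _ oOm _ _ hLip _ _ mu_bounds). Qed.

Lemma bm_dgrad1 s : bm (fun x => (dgrad mu s x).1).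
Proof.
rewrite (_ : (fun x => _) = (fun x => \sum_(t | is_sub t)
    (affine_grad (xvert t.2) (xcell t.1.1) (xedge t.1.2)
      (s.2 t.2) (s.1 t.1.1) (edge_value mu s t.1.2 t.2)).1 * \1_(sub t) x)).
  apply: bm_sum => t it; apply: bm_mul; [exact: bm_cst|exact/bm_indic/open_sub].
apply/funext => x; rewrite /dgrad (big_morph fst (id1 := 0) (op1 := +%R)) //.
by apply: eq_bigr => t _; rewrite mulrC.
Qed.

Lemma bm_dgrad2 s : bm (fun x => (dgrad mu s x).2).
Proof.
rewrite (_ : (fun x => _) = (fun x => \sum_(t | is_sub t)
    (affine_grad (xvert t.2) (xcell t.1.1) (xedge t.1.2)
      (s.2 t.2) (s.1 t.1.1) (edge_value mu s t.1.2 t.2)).2 * \1_(sub t) x)).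
  apply: bm_sum => t it; apply: bm_mul; [exact: bm_cst|exact/bm_indic/open_sub].
apply/funext => x; rewrite /dgrad (big_morph snd (id1 := 0) (op1 := +%R)) //.
by apply: eq_bigr => t _; rewrite mulrC.
Qed.

Lemma bm_P s : bm (P mu s).
Proof.
apply: bm_sum => t it; apply: bm_mul; last exact/bm_indic/open_sub.
exact: bm_affine.
Qed.

Lemma bm_ddot u v : bm (dgrad_ddot mu u v).
Proof.
by do ![apply: bm_add|apply: bm_mul]; do ?[exact: bm_dgrad1|exact: bm_dgrad2].
Qed.

Lemma bm_ddiv u : bm (ddiv mu u).
Proof.
by do ![apply: bm_add|apply: bm_mul]; do ?[exact: bm_dgrad1|exact: bm_dgrad2|exact: bm_cst].
Qed.

Lemma bm_LD p : LD M p -> bm p.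
Proof.
move=> [c ->]; apply: bm_sum => v _; apply: bm_mul; first exact: bm_cst.
exact/bm_indic/open_dual_cell.
Qed.

Definition stiffness u v : R := \int[leb2 R]_(x in Om) (mu x * dgrad_ddot mu u v x).
Definition div_form u p : R := \int[leb2 R]_(x in Om) (ddiv mu u x * p x).
Definition l2_form p q : R := \int[leb2 R]_(x in Om) (p x * q x).
Definition load v : R := \int[leb2 R]_(x in Om) dot (f x) (Pvec mu v x).

Lemma stiffnessC u v : stiffness u v = stiffness v u.
Proof. by apply: eq_Rintegral => x _; rewrite ddotC. Qed.

Lemma stiffness_lin k u u' v : stiffness (k *: u + u' : discrete_field M) v =
  k * stiffness u v + stiffness u' v.
Proof.
rewrite /stiffness -Rintegral_lin //; try by apply: bm_integrable => //;
  apply: bm_mul; [exact: bm_mu|exact: bm_ddot].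
apply: eq_Rintegral => x _; rewrite ddot_lin //.
by move: (dgrad_ddot mu u v x) (dgrad_ddot mu u' v x) => a b; ring.
Qed.

Lemma div_form_linl k u u' p : bm p ->
  div_form (k *: u + u' : discrete_field M) p = k * div_form u p + div_form u' p.
Proof.
move=> bp; rewrite /div_form -Rintegral_lin //; try by apply: bm_integrable => //;
  apply: bm_mul; [exact: bm_ddiv|].
apply: eq_Rintegral => x _; rewrite ddiv_lin //.
by move: (ddiv mu u x) (ddiv mu u' x) => a b; ring.
Qed.

Lemma div_form_linr k u p p' : bm p -> bm p' ->
  div_form u (fun x => k * p x + p' x) = k * div_form u p + div_form u p'.
Proof.
move=> bp bp'; rewrite /div_form -Rintegral_lin //; try by apply: bm_integrable => //;
  apply: bm_mul; [exact: bm_ddiv|].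
by apply: eq_Rintegral => x _; move: (ddiv mu u x) => a; ring.
Qed.

Lemma l2_formC p q : l2_form p q = l2_form q p.
Proof. by apply: eq_Rintegral => x _; rewrite mulrC. Qed.

Lemma l2_form_lin k p p' q : bm p -> bm p' -> bm q ->
  l2_form (fun x => k * p x + p' x) q = k * l2_form p q + l2_form p' q.
Proof.
move=> bp bp' bq; rewrite /l2_form -Rintegral_lin //;
  try by apply: bm_integrable => //; apply: bm_mul.
by apply: eq_Rintegral => x _; ring.
Qed.

Lemma load_integrable v :
  (leb2 R).-integrable (Om : set (measurableTypeR R * measurableTypeR R))
    (EFin \o (fun x => dot (f x) (Pvec mu v x))).
Proof.
have mOm := open_measurable_plane _ _ oOm.
have i1 := integrable_mul_bm _ _ oOm _ _ (bm_P (comp1 v)) (Lfun2_integrable _ _ oOm bOm _ hf1).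
have i2 := integrable_mul_bm _ _ oOm _ _ (bm_P (comp2 v)) (Lfun2_integrable _ _ oOm bOm _ hf2).
by have := integrableD mOm i1 i2; apply: eq_integrable.
Qed.

Lemma load_lin k u v : load (k *: u + v : discrete_field M) = k * load u + load v.
Proof.
rewrite /load -Rintegral_lin //; try exact: load_integrable.
apply: eq_Rintegral => x _; rewrite /Pvec comp1_lin comp2_lin !P_lin // /dot /=.
move: (P mu (comp1 u) x) (P mu (comp2 u) x) (P mu (comp1 v) x) (P mu (comp2 v) x).
by move=> a b c d; ring.
Qed.

Lemma stiffness_ge0 u : 0 <= stiffness u u.
Proof.
apply: Rintegral_ge0 => x Ox; have /andP[mu0 _] := mu_bounds x Ox.
apply: mulr_ge0; [exact: le_trans (ltW hlam_lo) mu0|exact: ddot_ge0].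
Qed.

Lemma l2_form_ge0 p : 0 <= l2_form p p.
Proof. by apply: Rintegral_ge0 => x Ox; rewrite -expr2 sqr_ge0. Qed.

Lemma stiffness_eq0 u : HD u -> stiffness u u = 0 -> u = 0.
Proof.
move=> hu u0.
have bg : bm (fun x => mu x * dgrad_ddot mu u u x).
  by apply: bm_mul; [exact: bm_mu|exact: bm_ddot].
have g0 x : Om x -> 0 <= mu x * dgrad_ddot mu u u x.
  move=> Ox; have /andP[mu0 _] := mu_bounds x Ox.
  apply: mulr_ge0; [exact: le_trans (ltW hlam_lo) mu0|exact: ddot_ge0].
have eqs (e : edgeI M) (v : vertI M) (K : cellI M) : eside e K -> eend e v -> u.1 K = u.2 v.
  move=> eK ev; have it : is_sub (K, e, v) by rewrite /is_sub /= eK ev.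
  have [|||x [xs Ox] /eqP] := Rintegral_eq0_open _ _ oOm bOm _
    ((sub (K, e, v) : set (R * R)) `&` Om) bg g0 u0.
  - by apply: openI => //; exact: open_sub.
  - exact: sub_meet_domain.
  - by [].
  have /andP[mu0 _] := mu_bounds x Ox.
  rewrite mulf_eq0 gt_eqF ?(lt_le_trans hlam_lo) //= => /eqP/ddot_eq0[].
  rewrite !(dgrad_sub _ _ _ _ _ _ _ it xs) /= => G1 G2.
  have A := subtri_nondeg eK ev.
  have [a1 b1] := affine_grad_eq0 _ _ _ _ _ _ _ A G1.
  have [a2 b2] := affine_grad_eq0 _ _ _ _ _ _ _ A G2.
  move: a1 b1 a2 b2; rewrite /= => a1 b1 a2 b2.
  by rewrite [LHS]surjective_pairing [RHS]surjective_pairing a1 b1 a2 b2.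
have [||v1 K1] := constant_vanishes R Om M hOm (comp1 u).
- by move=> v fv; rewrite /= hu.
- by move=> e v K eK ev; rewrite /= (eqs e v K).
have [||v2 K2] := constant_vanishes R Om M hOm (comp2 u).
- by move=> v fv; rewrite /= hu.
- by move=> e v K eK ev; rewrite /= (eqs e v K).
rewrite [u]surjective_pairing; congr (_, _); apply/ffunP => i; rewrite ffunE.
  by rewrite [LHS]surjective_pairing; congr (_, _); [exact: K1|exact: K2].
by rewrite [LHS]surjective_pairing; congr (_, _); [exact: v1|exact: v2].
Qed.

Lemma l2_form_eq0 p : LD M p -> l2_form p p = 0 -> p = fun=> 0.
Proof.
move=> hp p0; have [c pE] := hp.
suff c0 (v : vertI M) : c v = 0.
  by rewrite pE; apply/funext => x; rewrite big1 // => v _; rewrite c0 mul0r.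
have [||||x [xv Ox] /eqP] := Rintegral_eq0_open _ _ oOm bOm _
    ((dual_cell v : set (R * R)) `&` Om) (bm_mul _ _ _ _ (bm_LD _ hp) (bm_LD _ hp)) _ p0.
- by move=> y _; rewrite -expr2 sqr_ge0.
- by apply: openI => //; exact: open_dual_cell.
- exact: dual_cell_meet_domain.
- by [].
(* In the dual cell of [v] only the term of [v] survives, so the value of [p] at the point found is
   [c v]. *)
rewrite mulf_eq0 orbb pE (bigD1 v) //= big1 ?addr0.
  by rewrite indicE mem_set // mulr1 => /eqP.
move=> w wv; rewrite indicE memNset ?mulr0 // => xw.
have : (dual_cell w `&` dual_cell v) x by [].
by rewrite dual_cell_disjoint.
Qed.

Definition dof : finType := ((cellI M + vertI M) * bool + vertI M)%type.

(** The boundary condition is built into the parametrisation, so that coordinates range over all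
    functions on a finite type, as [bilinear_solvable] requires. *)
Definition field_of (d : dof -> R) : discrete_field M :=
  ([ffun K => (d (inl (inl K, false)), d (inl (inl K, true)))],
   [ffun v => if `[< frontier Om (xvert v) >] then 0
              else (d (inl (inr v, false)), d (inl (inr v, true)))]).

Definition pressure_of (d : dof -> R) (x : R * R) : R :=
  \sum_v d (inr v) * \1_(dual_cell v) x.

Lemma field_of_lin k d d' : field_of (fun i => k * d i + d' i) =
  k *: (field_of d : discrete_field M) + field_of d'.
Proof.
congr (_, _); apply/ffunP => i; rewrite !ffunE //.
by case: ifP => _; rewrite ?scaler0 ?addr0.
Qed.

Lemma pressure_of_lin k d d' : pressure_of (fun i => k * d i + d' i) =
  fun x => k * pressure_of d x + pressure_of d' x.
Proof.
apply/funext => x; rewrite /pressure_of mulr_sumr -big_split /=.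
by apply: eq_bigr => v _; rewrite mulrDl mulrA.
Qed.

Lemma HD_field_of d : HD (field_of d).
Proof. by move=> v fv; rewrite /= ffunE; case: asboolP. Qed.

Lemma LD_pressure_of d : LD M (pressure_of d).
Proof. by exists (fun y : vertI M => d (inr y)). Qed.

Lemma dof_surj u q : HD u -> LD M q ->
  exists2 d, field_of d = u & pressure_of d = q.
Proof.
move=> hu [c ->].
exists (fun i : dof => match i with
  | inl (inl K, false) => (u.1 K).1
  | inl (inl K, true) => (u.1 K).2
  | inl (inr v, false) => (u.2 v).1
  | inl (inr v, true) => (u.2 v).2
  | inr v => c v
  end) => //.
rewrite [RHS]surjective_pairing; congr (_, _); apply/ffunP => i; rewrite ffunE.
  by rewrite -surjective_pairing.
by case: asboolP => [/hu ->|_] //; rewrite -surjective_pairing.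
Qed.

Lemma LD_lin k p q : LD M p -> LD M q -> LD M (fun x => k * p x + q x).
Proof.
move=> [c ->] [d ->]; exists (fun y : vertI M => k * c y + d y).
apply/funext => x; rewrite mulr_sumr -big_split /=.
by apply: eq_bigr => v _; rewrite mulrDl mulrA.
Qed.

Lemma HD_lin k u v : HD u -> HD v -> HD (k *: u + v : discrete_field M).
Proof. by move=> hu hv w fw; rewrite /= !ffunE hu // hv // scaler0 addr0. Qed.

(** Stands for the penalty factor [lam * mesh_size M]. *)
Variable kappa : R.
Hypothesis kappa_gt0 : 0 < kappa.

Definition weak_solution u p : Prop :=
  (forall v, HD v -> stiffness u v - div_form v p = load v) /\
  (forall q, LD M q -> div_form u q = - kappa * l2_form p q).

Lemma energy_eq0 u p : HD u -> LD M p -> stiffness u u + kappa * l2_form p p = 0 ->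
  u = 0 /\ p = fun=> 0.
Proof.
move=> hu hp /eqP; rewrite paddr_eq0 ?stiffness_ge0 ?mulr_ge0 ?l2_form_ge0 ?(ltW kappa_gt0) //.
rewrite mulf_eq0 (gt_eqF kappa_gt0) /= => /andP[/eqP u0 /eqP p0].
by split; [exact: stiffness_eq0|exact: l2_form_eq0].
Qed.

Lemma weak_solution_uniq u p u' p' : HD u -> LD M p -> HD u' -> LD M p' ->
  weak_solution u p -> weak_solution u' p' -> u = u' /\ p = p'.
Proof.
move=> hu hp hu' hp' [E1 E2] [E1' E2'].
pose du : discrete_field M := -1 *: u' + u; pose dp x := -1 * p' x + p x.
have hdu : HD du by exact: HD_lin.
have hdp : LD M dp by exact: LD_lin.
have [bp bp' bdp] := And3 (bm_LD _ hp) (bm_LD _ hp') (bm_LD _ hdp).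
have [du0 dp0] : du = 0 /\ dp = fun=> 0.
  apply: energy_eq0 => //.
  have := E1 _ hdu; have := E1' _ hdu; have := E2 _ hdp; have := E2' _ hdp.
  have : stiffness du du = -1 * stiffness u' du + stiffness u du by exact: stiffness_lin.
  (* The mixed term is expanded in each argument: the second equations, tested with [dp], split the
     velocity, and the first ones, tested with [du], split the pressure. Equating both expansions
     leaves the energy of the difference. *)
  have : div_form du dp = -1 * div_form u' dp + div_form u dp by exact: div_form_linl.
  have : div_form du dp = -1 * div_form du p' + div_form du p by exact: div_form_linr.
  have : l2_form dp dp = -1 * l2_form p' dp + l2_form p dp by exact: l2_form_lin.
  move: (stiffness du du) (stiffness u' du) (stiffness u du) (div_form du dp)
    (div_form u' dp) (div_form u dp) (div_form du p') (div_form du p)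
    (l2_form dp dp) (l2_form p' dp) (l2_form p dp) (load du).
  move=> a1 a2 a3 b1 b2 b3 b4 b5 c1 c2 c3 l ->; lra.
split.
  by move: du0; rewrite /du scaleN1r addrC => /subr0_eq.
apply/funext => x; have := congr1 (fun g => g x) dp0; rewrite /dp mulN1r addrC.
exact: subr0_eq.
Qed.

(* The two equations are summed into one equation for a single bilinear form,
   whose value on the diagonal is the energy. *)
Lemma weak_solution_exists : exists u p, [/\ HD u, LD M p & weak_solution u p].
Proof.
pose A (d e : dof -> R) := stiffness (field_of d) (field_of e)
  - div_form (field_of e) (pressure_of d) + div_form (field_of d) (pressure_of e)
  + kappa * l2_form (pressure_of d) (pressure_of e).
have bp d : bm (pressure_of d) by exact/bm_LD/LD_pressure_of.
have [|||d0 Ad0|d Ad] := @bilinear_solvable R dof A (fun e => load (field_of e)).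
- move=> k d1 d2 e; rewrite /A field_of_lin pressure_of_lin stiffness_lin.
  rewrite div_form_linr // div_form_linl // l2_form_lin //.
  move: (stiffness _ _) (stiffness _ _) (div_form _ _) (div_form _ _) (div_form _ _)
   (div_form _ _) (l2_form _ _) (l2_form _ _) => *; ring.
- move=> k d1 d2 e; rewrite /A field_of_lin pressure_of_lin stiffnessC stiffness_lin.
  rewrite div_form_linr // div_form_linl // l2_formC l2_form_lin //.
  rewrite ![stiffness _ (field_of e)]stiffnessC ![l2_form _ (pressure_of e)]l2_formC.
  move: (stiffness _ _) (stiffness _ _) (div_form _ _) (div_form _ _) (div_form _ _)
   (div_form _ _) (l2_form _ _) (l2_form _ _) => *; ring.
- by move=> k d1 d2; rewrite field_of_lin load_lin.
- have [-> _] := energy_eq0 (field_of d0) (pressure_of d0) (HD_field_of _)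
    (LD_pressure_of _) ltac:(by move: Ad0; rewrite /A; lra).
  by have := load_lin (-1) 0 0; rewrite scaler0 addr0 mulN1r addNr.
exists (field_of d), (pressure_of d).
have z1 u : stiffness u 0 = 0.
  by rewrite stiffnessC; have := stiffness_lin (-1) 0 0 u; rewrite scaler0 addr0 mulN1r addNr.
have z2 p : bm p -> div_form 0 p = 0.
  by move=> /(div_form_linl (-1) 0 0 p); rewrite scaler0 addr0 mulN1r addNr.
have z3 u : div_form u (fun=> 0) = 0.
  rewrite /div_form (_ : (fun x => _) = fun x => 0); last by apply/funext => x; rewrite mulr0.
  by rewrite Rintegral_cst ?mul0r //; exact: open_measurable_plane.
have z4 p : l2_form p (fun=> 0) = 0.
  rewrite /l2_form (_ : (fun x => _) = fun x => 0); last by apply/funext => x; rewrite mulr0.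
  by rewrite Rintegral_cst ?mul0r //; exact: open_measurable_plane.
have z5 : load 0 = 0.
  by have := load_lin (-1) 0 0; rewrite scaler0 addr0 mulN1r addNr.
have LD0 : LD M (fun=> 0).
  by exists (fun=> 0); apply/funext => x; rewrite big1 // => v _; rewrite mul0r.
split; [exact: HD_field_of|exact: LD_pressure_of|split].
(* Coordinates of [(v, 0)] isolate the first equation from the sum, and those of [(0, q)] the
   second. *)
- move=> v hv; have [e ev ep] := dof_surj v _ hv LD0.
  by have := Ad e; rewrite /A ev ep z3 z4 mulr0 !addr0.
- move=> q hq; have [e ev ep] := dof_surj 0 _ (fun _ _ => ffunE _ _) hq.
  have := Ad e; rewrite /A ev ep z1 z2 // z5 subr0 add0r.
  by rewrite mulNr => /eqP; rewrite addr_eq0 => /eqP.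
Qed.

End weak_forms.

Theorem mainTheorem1 (R : realType) (Om : set (R * R)) (f : R * R -> R * R)
    (mu : R * R -> R) (lam_lo lam_hi Lam lam : R) (M : mesh Om)
    (hOm : polygonal_domain Om)
    (hf1 : ((fun x => (f x).1) \_ Om) \in Lfun (leb2 R) 2%:E)
    (hf2 : ((fun x => (f x).2) \_ Om) \in Lfun (leb2 R) 2%:E)
    (hlam_lo : 0 < lam_lo)
    (hmu : {ae leb2 R, forall x, Om x -> lam_lo <= mu x <= lam_hi})
    (hLip : forall x y, closure Om x -> closure Om y ->
       `|mu x - mu y| <= Lam * enorm (x - y))
    (hlam : 0 < lam)
    (hM : flux_nondegenerate M mu) :
  exists! up : discrete_field M * (R * R -> R),
    [/\ HD up.1, LD M up.2,
      forall vh : discrete_field M, HD vh ->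
        \int[leb2 R]_(x in Om) (mu x * dgrad_ddot mu up.1 vh x)
        - \int[leb2 R]_(x in Om) (ddiv mu vh x * up.2 x)
        = \int[leb2 R]_(x in Om) dot (f x) (Pvec mu vh x) &
      forall q : R * R -> R, LD M q ->
        \int[leb2 R]_(x in Om) (ddiv mu up.1 x * q x)
        = - lam * mesh_size M * \int[leb2 R]_(x in Om) (up.2 x * q x)].
Proof.
have kappa_gt0 : 0 < lam * mesh_size M by rewrite mulr_gt0 // mesh_size_gt0.
have [u [p [hu hp [E1 E2]]]] := weak_solution_exists R Om M f mu lam_lo lam_hi Lam
  hOm hf1 hf2 hlam_lo hmu hLip hM _ kappa_gt0.
exists (u, p); split.
  by split=> // q hq; rewrite /= mulNr; exact: E2.
move=> [u' p'] [/= hu' hp' E1' E2'].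
have [||-> ->] := weak_solution_uniq R Om M f mu lam_lo lam_hi Lam
  hOm hlam_lo hmu hLip hM _ kappa_gt0 u p u' p' hu hp hu' hp'; last by [].
- by [].
- by split=> // q hq; rewrite -mulNr; exact: E2'.
Qed.
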